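(* Let $n\ge 2$, $1<p<+\infty$, let $\Omega\subset\mathbb{R}^n$ be a $C^1$ domain (bounded or unbounded), let $f\in C^1(\mathbb{R})$ and let $\kappa\ge 0$ be a constant. Let $u$ be a bounded $C^3$ solution of \[ \begin{cases} \mathrm{div}\left(|\nabla u|^{p-2}\nabla u\right)+f(u)=0 & \text{in } \Omega,\\ u>0 & \text{in } \Omega,\\ u=0 & \text{on } \partial\Omega,\\ \partial_\nu u=-\kappa & \text{on } \partial\Omega, \end{cases} \] where $\nu$ is the exterior unit normal to $\partial\Omega$. Let $F\in C^2(\mathbb{R})$ be a primitive of $f$ with $F\le 0$ on $\mathbb{R}$, and define \[ Q(x)=\frac{p-1}{p}|\nabla u(x)|^p+F(u(x)),\qquad x\in\Omega . \] Then \[ Q(x)\le \max\Big\{0,\;F(0)+\frac{p-1}{p}\kappa^p\Big\}\quad\text{for all } x\in\Omega . \] Moreover, if there exists $x_0\in\Omega$ with $Q(x_0)=\max\{0,F(0)+\frac{p-1}{p}\kappa^p\}$, and, in the case $p>2$, it is additionally assumed that for every $u_0\in\mathbb{R}$ with $F(u_0)=0$ one has $F(s)=O(|s-u_0|^p)$ as $s\to u_0$, then $Q$ is constant in $\Omega$, $\Omega$ is a half-space and $u$ is parallel.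
   Context: A primitive of $f$ is a function $F$ with $F'=f$. A solution $u$ on a half-space $\Omega$ is called parallel (one-dimensional) if there exist $x_0,a\in\mathbb{R}^n$ and $g:[0,+\infty)\to\mathbb{R}$ such that $\Omega=\{x: a\cdot(x-x_0)>0\}$ and $u(x)=g(a\cdot(x-x_0))$ on $\Omega$.
   Formalization: Ω is assumed different from R^n, so that ∂Ω is nonempty: for Ω=R^n the rigidity claim fails (u constant, f=F=0, κ=0). The solution is taken as C^3 in Ω, C^1 up to ∂Ω, with the equation holding pointwise. *)

(* Defs.v *)
From HB Require Import structures.
From mathcomp Require Import all_boot all_order all_algebra.
From mathcomp Require Import all_classical all_reals all_analysis.
Set Implicit Arguments. Unset Strict Implicit. Unset Printing Implicit Defensive.
Import Order.TTheory GRing.Theory Num.Theory.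
Import numFieldNormedType.Exports.
Local Open Scope classical_set_scope.
Local Open Scope ring_scope.

Section Defs.
Variables (R : realType) (n : nat).
Notation V := 'rV[R]_n.

Definition evec (i : 'I_n) : V := delta_mx 0 i.

(* Euclidean inner product and Euclidean norm (NOT the sup norm of 'rV) *)
Definition dotv (a b : V) : R := \sum_(i < n) a 0 i * b 0 i.
Definition enorm (a : V) : R := Num.sqrt (dotv a a).

Definition partial (i : 'I_n) (g : V -> R) (x : V) : R := 'D_(evec i) g x.
Definition grad (g : V -> R) (x : V) : V := \row_(i < n) partial i g x.

Fixpoint Ck (k : nat) (A : set V) (g : V -> R) : Prop :=
  match k with
  | 0 => forall x, A x -> {for x, continuous g}
  | k'.+1 => (forall x, A x -> {for x, continuous g}) /\
             (forall x, A x -> forall i, derivable g x (evec i)) /\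
             (forall i, Ck k' A (partial i g))
  end.

Definition boundary_of (O : set V) : set V := [set x | closure O x /\ ~ O x].

Definition local_defining (O : set V) (x0 : V) (r : R) (rho : V -> R) : Prop :=
  0 < r /\ Ck 1 (ball x0 r) rho /\ grad rho x0 != 0 /\
  (forall y, ball x0 r y -> (O y <-> rho y < 0)).

Definition C1_domain (O : set V) : Prop :=
  open O /\ connected O /\ O !=set0 /\
  (forall x0, boundary_of O x0 -> exists r rho, local_defining O x0 r rho).

Definition exterior_normal (O : set V) (x nu : V) : Prop :=
  exists r rho, local_defining O x r rho /\
    nu = (enorm (grad rho x))^-1 *: grad rho x.

Definition plap_field (p : R) (u : V -> R) (x : V) : V :=
  if grad u x == 0 then 0 else (enorm (grad u x) `^ (p - 2)) *: grad u x.

Definition plap_eq_at (p : R) (f : R -> R) (u : V -> R) (x : V) : Prop :=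
  (forall i, derivable (fun y => plap_field p u y 0 i) x (evec i)) /\
  \sum_(i < n) 'D_(evec i) (fun y => plap_field p u y 0 i) x + f (u x) = 0.

Definition half_space (O : set V) : Prop :=
  exists (x0 a : V), a != 0 /\ O = [set x | 0 < dotv a (x - x0)].

Definition parallel (O : set V) (u : V -> R) : Prop :=
  exists (x0 a : V) (g : R -> R), O = [set x | 0 < dotv a (x - x0)] /\
    forall x, O x -> u x = g (dotv a (x - x0)).

End Defs.

(* Main.v *)
(** Where [v = grad u] does not vanish, put [A = I + (p - 2) v v^T / |v|^2] and
    [q = v . grad Q / |v|^2].  Differentiating the equation once, one finds
      [|v|^(p-2) A : D^2 Q = (p-1) q^2 + 2/(p-1) t^2 - p f(u) q + (p-1) |v|^(2p-4) |H'|^2],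
    where [t |v|] is the tangential part of [grad Q] and [H'] is the Hessian of [u] restricted to
    the orthogonal of [v].  Hence [Q] is a subsolution of a linear elliptic equation.

    The bound is a Bernstein argument on [closure Omega] cut off in a large ball: since [F <= 0],
    [|v|] is bounded below where [Q > 0], and dividing [Q] by a concave function of [u] creates
    a negative term of order [|v|^2] that absorbs the errors due to the cut-off.  On the
    boundary [|grad u| = kappa].

    If [Q] attains [c] in [Omega], the set [Q = c] is open: near points with [v <> 0] by the strong
    maximum principle, near critical points because then [c = F(u) = 0] and the bound reads
    [|grad u| <= C |u - u0|], so that [u] is locally constant.  A critical point would make [u]
    constant, contradicting [u = 0] on the boundary.  Thus [v] never vanishes, [t = 0] and
    [H' = 0], which means that [v / |v|] is a constant [a].  As [u] is nondecreasing along every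
    direction [e] with [a . e >= 0], such rays cannot reach the boundary, and [Omega] is a
    half-space. *)
Require Import Defs.
From HB Require Import structures.
From mathcomp Require Import all_boot all_order all_algebra.
From mathcomp Require Import ring lra.
From mathcomp Require Import all_classical all_reals all_analysis.
Set Implicit Arguments. Unset Strict Implicit. Unset Printing Implicit Defensive.
Import Order.TTheory GRing.Theory Num.Theory.
Import numFieldNormedType.Exports.
Local Open Scope classical_set_scope.
Local Open Scope ring_scope.

(** [Omega] may be unbounded and [grad u] is not assumed bounded, so [Q] need not attain its
    supremum; moreover [Q] is known to be twice differentiable only away from critical points. The
    differential inequality is therefore used in viscosity form: where [Q - psi] has a local maximum
    at a noncritical point, the derivatives of [psi] replace those of [Q]. One family of test
    functions, [mu t0(u) s0(|x - x1|^2)], serves both the bound and the strong maximum principle.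
    The exponent [p] of the cut-off [s] matches the growth of [Q]: since [Q <= |grad u|^p], the
    product [s^p Q] is at most [(s |grad u|)^p], and the condition at the maximum becomes a
    quadratic inequality for [s |grad u|]. For [p <= 2] the growth condition on [F] is automatic,
    since [F] is maximal at its zeros and [f] is differentiable, whence [F(s) = O(|s - u0|^2)]. For
    [p > 2] such a zero only bounds [|grad u|] by a power of [|u - u0|] with exponent [2/p < 1],
    which does not force [u] to be locally constant. *)

(** * One-variable derivatives and limits of real powers *)

Lemma is_derive_affine (R : realType) (a b t : R) :
  is_derive t (1 : R) (fun s : R => a + b * s) b.
Proof.
rewrite (_ : (fun s => _) = cst a + b \*: (id : R -> R)) //.
by apply: is_derive_eq; rewrite add0r [_ *: _]mulr1.
Qed.

Lemma is_derive_expRM (R : realType) (a t : R) :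
  is_derive t (1 : R) (fun s : R => expR (a * s)) (a * expR (a * t)).
Proof.
have := @is_derive1_comp R expR (fun s => 0 + a * s) t _ _ (is_derive_expR _)
  (is_derive_affine 0 a t).
rewrite add0r mulrC; congr is_derive; apply/funext => s /=; by rewrite add0r.
Qed.

Lemma is_derive_powR_affine (R : realType) (a b q t : R) : 0 < a + b * t ->
  is_derive t (1 : R) (fun s : R => (a + b * s) `^ q) (q * (a + b * t) `^ (q - 1) * b).
Proof.
move=> h; exact: (@is_derive1_comp R (fun s => s `^ q) (fun s => a + b * s) t _ _
  (is_derive1_powR q h) (is_derive_affine a b t)).
Qed.

Lemma is_deriveMl (R : realType) (k : R) (g : R -> R) (t d : R) :
  is_derive t (1 : R) g d -> is_derive t (1 : R) (fun s => k * g s) (k * d).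
Proof.
by move=> H; exact: (is_deriveZ k H).
Qed.

(** The limit [a = 0] must be allowed because it occurs at critical points of [u]; the power need
    not be differentiable there, and an explicit radius [e^(1/q)] is used instead. *)
Lemma cvg_powR (R : realType) (T : Type) (A : set_system T) {FA : Filter A}
    (h : T -> R) (a q : R) : 0 < q -> 0 <= a -> (\forall x \near A, 0 <= h x) ->
  h x @[x --> A] --> a -> h x `^ q @[x --> A] --> a `^ q.
Proof.
move=> q0; rewrite le_eqVlt => /orP[/eqP <-|a0] hn ha.
  rewrite powR0 ?gt_eqF//; apply/cvgrPdist_lt => e e0.
  have r0 : 0 < e `^ q^-1 by rewrite powR_gt0.
  move/cvgrPdist_lt: ha => /(_ _ r0) ha; near=> x.
  have hx : 0 <= h x by near: x.
  have : `|0 - h x| < e `^ q^-1 by near: x.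
  rewrite !sub0r !normrN (ger0_norm hx) (ger0_norm (powR_ge0 _ _)).
  move=> /(gt0_ltr_powR q0) /=; rewrite -powRrM mulVf ?gt_eqF// powRr1 ?ltW//.
  by apply; rewrite nnegrE// ltW.
have c : {for a, continuous (fun s : R => s `^ q)}.
  apply: differentiable_continuous; apply/derivable1_diffP.
  by have [] := is_derive1_powR q a0.
exact: (cvg_comp _ _ ha c).
Unshelve. all: by end_near. Qed.

Lemma cvgr_neq (R : realType) (T : Type) (A : set_system T) {FA : Filter A}
    (h : T -> R) (a : R) : h x @[x --> A] --> a ->
  forall b, a != b -> \forall x \near A, h x != b.
Proof.
move=> /cvgrPdist_lt ha b ab; have d0 : 0 < `|a - b| by rewrite normr_gt0 subr_eq0.
near=> x; apply/eqP => hb; suff : `|a - h x| < `|a - b| by rewrite hb ltxx.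
by near: x; exact: ha.
Unshelve. all: by end_near. Qed.


Lemma near_ex_ball (R : realType) (V : normedModType R) (x : V) (P : set V) :
  (\forall y \near x, P y) -> exists2 r : R, 0 < r & forall y, ball x r y -> P y.
Proof. by move=> /nbhs_ballP[r /= r0 H]; exists r. Qed.

Lemma cvg_sumr (R : realType) (T : Type) (F : set_system T) {FF : Filter F}
    (m : nat) (h : 'I_m -> T -> R) (a : 'I_m -> R) :
  (forall i, h i x @[x --> F] --> a i) ->
  \sum_(i < m) h i x @[x --> F] --> \sum_(i < m) a i.
Proof. by move=> H; apply: cvg_big => //; exact: add_continuous. Qed.

Lemma coord_continuous_at (R : realType) (n : nat) (y : 'rV[R]_n) i :
  {for y, continuous (fun z : 'rV[R]_n => z 0 i)}.
Proof. by refine (@coord_continuous R 1 n 0 i y). Qed.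

(** * Directional derivatives studied along lines *)

Section LineCalculus.
Variables (R : realType) (V : normedModType R).
Implicit Types (g : V -> R) (x y e w : V).

Lemma is_deriveP g x e (d : R) :
  is_derive x e g d <-> (h^-1 *: (g (h *: e + x) - g x) @[h --> 0^'] --> d).
Proof.
split => [[dg <-]|cg].
  by move/cvg_ex: dg => -[l gl]; rewrite /derive; rewrite (cvg_lim _ gl).
split; first by apply/cvg_ex; exists d.
exact: (cvg_lim _ cg).
Qed.

Lemma is_derive_line g y e (t d : R) :
  is_derive (y + t *: e) e g d <-> is_derive t 1 (fun s : R => g (y + s *: e)) d.
Proof.
have E : (fun h : R => h^-1 *: (g (h *: e + (y + t *: e)) - g (y + t *: e))) =
   (fun h : R => h^-1 *: (g (y + (h *: (1 : R) + t) *: e) - g (y + t *: e))).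
  by apply/funext => h; rewrite scalerDl [h *: (1 : R)]mulr1 addrCA.
split=> -[]; rewrite /derivable /derive => H <-; split; rewrite /derivable /derive;
  move: H; by rewrite E.
Qed.

Lemma is_derive_line0 g x e (d : R) :
  is_derive x e g d <-> is_derive (0 : R) 1 (fun s : R => g (x + s *: e)) d.
Proof. by rewrite -is_derive_line scale0r addr0. Qed.

Lemma is_deriveZdir g x e (k d : R) :
  is_derive x e g d -> is_derive x (k *: e) g (k * d).
Proof.
move=> /is_derive_line0 H; apply/is_derive_line0.
have H1 : is_derive (0 : R) 1 (fun s : R => s * k) k.
  have := @is_deriveM _ _ (id : R -> R) (cst k) 0 1 1 0 _ _.
  move=> /(_ (is_derive_id _ _) (is_derive_cst _ _ _)) H1.
  apply: (is_derive_eq H1).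
  by rewrite /= scaler0 add0r /cst [k *: _]mulr1.
have H2 : is_derive ((fun s : R => s * k) 0) 1 (fun s : R => g (x + s *: e)) d.
  by rewrite /= mul0r.
have := @is_derive1_comp _ _ (fun s : R => s * k) 0 _ _ H2 H1; rewrite mulrC => H3.
rewrite (_ : (fun s => _) = (fun s => g (x + s *: e)) \o (fun s => s * k)) //.
by apply/funext => s /=; rewrite scalerA.
Qed.

Lemma is_derive_compR g (h : R -> R) x e (d d' : R) :
  is_derive (g x) 1 h d' -> is_derive x e g d ->
  is_derive x e (fun y => h (g y)) (d' * d).
Proof.
move=> Hh /is_derive_line0 Hg; apply/is_derive_line0.
apply: (is_derive1_comp (g := fun s => g (x + s *: e))) => //.
by rewrite scale0r addr0.
Qed.

Lemma MVT_dir g (dg : V -> R) y w :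
  (forall t : R, 0 <= t <= 1 -> is_derive (y + t *: w) w g (dg (y + t *: w))) ->
  exists2 t : R, 0 < t < 1 & g (y + w) - g y = dg (y + t *: w).
Proof.
move=> H.
have D (s : R) : s \in `]0, 1[ ->
    is_derive s 1 (fun s => g (y + s *: w)) (dg (y + s *: w)).
  rewrite in_itv /= => /andP[s0 s1]; apply/is_derive_line.
  by apply: H; rewrite !ltW.
have C : {within `[0, 1], continuous (fun s : R => g (y + s *: w))}.
  apply: derivable_within_continuous => s; rewrite in_itv /= => s01.
  by have /is_derive_line[] := H s s01.
have [c c01 E] := MVT ltr01 D C.
exists c; first by move: c01; rewrite in_itv.
by move: E; rewrite scale1r scale0r addr0 subr0 mulr1.
Qed.

(** The increment along [a + b] is a step along [a] from [x] followed by a step along [b]. By the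
    mean value theorem the second is [h] times [db] at a nearby point, so only [db] needs
    continuity. *)
Lemma is_deriveD_dir g (db : V -> R) x a b (da : R) :
  is_derive x a g da -> (\forall y \near x, is_derive y b g (db y)) ->
  {for x, continuous db} -> is_derive x (a + b) g (da + db x).
Proof.
move=> /is_deriveP Ha Hb Hc; apply/is_deriveP.
have Hd : (h^-1 *: (g (h *: (a + b) + x) - g (h *: a + x)) @[h --> 0^'] --> db x).
  apply/cvgrPdist_lt => eps eps0.
  have Hc' : \forall y \near x, `|db x - db y| < eps.
    by move/cvgrPdist_lt: Hc => /(_ _ eps0).
  have [r r0 Hr] := near_ex_ball (filterI Hb Hc').
  have C0 : 0 < `|a| + `|b| + 1 by rewrite ltr_wpDl// addr_ge0.
  have d0 : 0 < r / (`|a| + `|b| + 1) by rewrite divr_gt0.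
  near=> h.
  have h0 : h != 0 by near: h; exact: nbhs_dnbhs_neq.
  have hd : `|h| < r / (`|a| + `|b| + 1).
    by near: h; exact: dnbhs0_lt.
  have inb : forall t : R, 0 <= t <= 1 -> ball x r (h *: a + x + t *: (h *: b)).
    move=> t /andP[t0 t1]; rewrite -ball_normE /= opprD addrA.
    rewrite opprD addrCA subrr addr0 -opprD normrN.
    rewrite scalerA [t * h]mulrC -scalerA -scalerDr normrZ.
    rewrite (@le_lt_trans _ _ (`|h| * (`|a| + `|b| + 1)))//; last first.
      by rewrite -ltr_pdivlMr.
    rewrite ler_wpM2l// (le_trans (ler_normD _ _))// normrZ ger0_norm//.
    have : t * `|b| <= `|b| by rewrite ler_piMl.
    by lra.
  have D t : 0 <= t <= 1 -> is_derive (h *: a + x + t *: (h *: b)) (h *: b) g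
      (h * db (h *: a + x + t *: (h *: b))).
    move=> t01; apply: is_deriveZdir.
    by have [] := Hr _ (inb t t01).
  have [t t01 E] := @MVT_dir g (fun y => h * db y) _ _ D.
  rewrite [h *: (a + b)]scalerDr addrAC E [_ *: _]mulrA mulVf// mul1r.
  have t01' : 0 <= t <= 1 by case/andP: t01 => ? ?; rewrite !ltW.
  by have [] := Hr _ (inb t t01').
rewrite (_ : (fun h => _) = (fun h => h^-1 *: (g (h *: a + x) - g x)) +
    (fun h => h^-1 *: (g (h *: (a + b) + x) - g (h *: a + x)))); last first.
  by apply/funext => h; rewrite [RHS]/GRing.add /= -scalerDr [in RHS]addrC addrA subrK.
exact: cvgD.
Unshelve. all: by end_near. Qed.

Lemma derive_comm g (ga gb gab gba : V -> R) x a b :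
  (\forall y \near x, is_derive y a g (ga y)) ->
  (\forall y \near x, is_derive y b g (gb y)) ->
  (\forall y \near x, is_derive y b ga (gab y)) ->
  (\forall y \near x, is_derive y a gb (gba y)) ->
  {for x, continuous gab} -> {for x, continuous gba} -> gab x = gba x.
Proof.
(* A second difference divided by [h^2] is the mixed derivative at some point as close to [x] as
   desired. It does not depend on the order of [a] and [b], so continuity at [x] identifies the two
   mixed derivatives. *)
suff key : forall g (ga gab : V -> R) x a b (P : set V),
  (\forall y \near x, is_derive y a g (ga y)) ->
  (\forall y \near x, is_derive y b ga (gab y)) ->
  nbhs x P ->
  \forall h \near (0 : R)^'+, exists2 xi, P xi &
    g (x + h *: a + h *: b) - g (x + h *: b) - (g (x + h *: a) - g x) =
    h * (h * gab xi).
  move=> Ha Hb Hab Hba Cab Cba; apply/eqP; rewrite -subr_eq0 -normr_le0.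
  apply/ler_addgt0Pr => eps eps0; rewrite add0r.
  have e2 : 0 < eps / 2 by lra.
  have Pab : nbhs x [set y | `|gab x - gab y| < eps / 2].
    by move/cvgrPdist_lt: Cab => /(_ _ e2).
  have Pba : nbhs x [set y | `|gba x - gba y| < eps / 2].
    by move/cvgrPdist_lt: Cba => /(_ _ e2).
  have K1 := key _ _ _ _ _ _ _ Ha Hab Pab.
  have K2 := key _ _ _ _ _ _ _ Hb Hba Pba.
  near (0 : R)^'+ => h.
  have [xi /= X1 E1] : exists2 xi, [set y | `|gab x - gab y| < eps / 2] xi &
    g (x + h *: a + h *: b) - g (x + h *: b) - (g (x + h *: a) - g x) =
    h * (h * gab xi) by near: h.
  have [xi' /= X2 E2] : exists2 xi, [set y | `|gba x - gba y| < eps / 2] xi &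
    g (x + h *: b + h *: a) - g (x + h *: a) - (g (x + h *: b) - g x) =
    h * (h * gba xi) by near: h.
  have h0 : 0 < h by near: h; exact: nbhs_right_gt.
  have E3 : gab xi = gba xi'.
    have hh : h * h != 0 by rewrite mulf_neq0// gt_eqF.
    apply: (mulfI hh); rewrite -!mulrA -E1 -E2 (addrAC x (h *: b)).
    by ring.
  have -> : gab x - gba x = (gab x - gab xi) - (gba x - gba xi').
    by rewrite E3; ring.
  by rewrite (le_trans (ler_normB _ _))// ltW//; move: X1 X2; lra.
move=> {}g {}ga {}gab {}x {}a {}b P Ha Hab HP.
have [r r0 Hr] := near_ex_ball (filterI (filterI Ha Hab) HP).
have C0 : 0 < `|a| + `|b| + 1 by rewrite ltr_wpDl// addr_ge0.
have d0 : 0 < r / (`|a| + `|b| + 1) by rewrite divr_gt0.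
near=> h.
have h0 : 0 < h by near: h; exact: nbhs_right_gt.
have hd : h < r / (`|a| + `|b| + 1) by near: h; exact: nbhs_right_lt.
have inb : forall s t : R, 0 <= s <= 1 -> 0 <= t <= 1 ->
    ball x r (x + s *: (h *: a) + t *: (h *: b)).
  move=> s t /andP[s0 s1] /andP[t0 t1]; rewrite -ball_normE /=.
  rewrite -addrA opprD addrA subrr add0r normrN.
  rewrite !scalerA [t * h]mulrC [s * h]mulrC -!scalerA -scalerDr normrZ.
  rewrite (@le_lt_trans _ _ (h * (`|a| + `|b| + 1)))//; last first.
    by rewrite -ltr_pdivlMr.
  rewrite gtr0_norm//; apply: ler_wpM2l; first exact: ltW.
  rewrite (le_trans (ler_normD _ _))// !normrZ !ger0_norm//.
  have : t * `|b| <= `|b| by rewrite ler_piMl.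
  have : s * `|a| <= `|a| by rewrite ler_piMl.
  by lra.
have z01 : 0 <= (0 : R) <= 1 by rewrite lexx ler01.
have o01 : 0 <= (1 : R) <= 1 by rewrite lexx ler01.
have D s : 0 <= s <= 1 -> is_derive (x + s *: (h *: a)) (h *: a)
    (fun y => g (y + h *: b) - g y)
    ((fun y => h * (ga (y + h *: b) - ga y)) (x + s *: (h *: a))).
  move=> s01.
  rewrite mulrBr.
  apply: is_deriveB; last first.
    apply: is_deriveZdir.
    by have [[+ _] _] := Hr _ (inb s 0 s01 z01); rewrite scale0r addr0.
  have H1 : is_derive (x + s *: (h *: a) + h *: b) (h *: a) g
       (h * ga (x + s *: (h *: a) + h *: b)).
    apply: is_deriveZdir.
    by have [[+ _] _] := Hr _ (inb s 1 s01 o01); rewrite scale1r.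
  move: H1; rewrite !is_derive_line0.
  under [X in is_derive _ _ X _ -> _]eq_fun do rewrite addrAC.
  by [].
have [s s01 E] := @MVT_dir _ (fun y => h * (ga (y + h *: b) - ga y)) _ _ D.
have s01' : 0 <= s <= 1 by case/andP: s01 => ? ?; rewrite !ltW.
have D' t : 0 <= t <= 1 -> is_derive (x + s *: (h *: a) + t *: (h *: b)) (h *: b) ga
    (h * gab (x + s *: (h *: a) + t *: (h *: b))).
  move=> t01; apply: is_deriveZdir.
  by have [[]] := Hr _ (inb s t s01' t01).
have [t t01 E'] := @MVT_dir ga (fun y => h * gab y) _ _ D'.
exists (x + s *: (h *: a) + t *: (h *: b)).
  have t01' : 0 <= t <= 1 by case/andP: t01 => ? ?; rewrite !ltW.
  by have [] := Hr _ (inb s t s01' t01').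
by rewrite -E' -E; ring.
Unshelve. all: by end_near. Qed.

Lemma ball_lin x e (r : R) : 0 < r ->
  exists2 d : R, 0 < d & forall h : R, `|h| < d -> ball x r (x + h *: e).
Proof.
move=> r0; have C0 : 0 < `|e| + 1 by rewrite ltr_wpDl.
exists (r / (`|e| + 1)); first by rewrite divr_gt0.
move=> h hd; rewrite -ball_normE /= opprD addrA subrr add0r normrN normrZ.
rewrite (@le_lt_trans _ _ (`|h| * (`|e| + 1)))//; last by rewrite -ltr_pdivlMr.
by rewrite ler_wpM2l// lerDl.
Qed.

Lemma local_max_derive g (dg : V -> R) x e :
  (\forall y \near x, is_derive y e g (dg y)) ->
  (\forall y \near x, g y <= g x) -> dg x = 0.
Proof.
move=> H1 H2; have [r r0 Hr] := near_ex_ball (filterI H1 H2).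
have [d d0 Hd] := ball_lin x e r0.
have B (s : R) : s \in `]- d, d[ -> ball x r (x + s *: e).
  by rewrite in_itv /= => sd; apply: Hd; rewrite ltr_norml.
have D (s : R) : s \in `]- d, d[ -> is_derive s 1 (fun s : R => g (x + s *: e)) (dg (x + s *: e)).
  by move=> sd; apply/is_derive_line; have [] := Hr _ (B _ sd).
have d00 : (0 : R) \in `]- d, d[ by rewrite in_itv /= d0 oppr_lt0 d0.
have [] := @derive1_at_max R (fun s : R => g (x + s *: e)) (- d) d 0 _ _ d00 _.
- by lra.
- by move=> s /D[].
- move=> s /B/Hr[_]; by rewrite scale0r addr0.
- by move=> _ E0; have [_] := D _ d00; rewrite E0 scale0r addr0.
Qed.

(** If [d2] were positive, [dg], which vanishes at [x], would be positive just after [x] along [e],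
    and the mean value theorem would make [g] exceed [g x]. The second derivative is thus needed at
    [x] only. *)
Lemma local_max_derive2 g (dg : V -> R) x e (d2 : R) :
  (\forall y \near x, is_derive y e g (dg y)) ->
  (\forall y \near x, g y <= g x) -> is_derive x e dg d2 -> d2 <= 0.
Proof.
move=> H1 H2 H3; have dg0 := local_max_derive H1 H2.
rewrite leNgt; apply/negP => d20.
have [r r0 Hr] := near_ex_ball (filterI H1 H2).
have [d d0 Hd] := ball_lin x e r0.
move/is_deriveP: H3; rewrite dg0 => /cvgrPdist_lt /(_ _ d20) /=.
move=> /(@near_ex_ball R R^o)[d' d'0 Hd'].
pose t := Num.min d d' / 2.
have t0 : 0 < t by rewrite divr_gt0// lt_min d0.
have [td td'] : t < d /\ t < d'.
  have m0 : 0 < Num.min d d' by rewrite lt_min d0.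
  have : t < Num.min d d' by rewrite /t; lra.
  by rewrite lt_min => /andP.
have D s : 0 <= s <= 1 -> is_derive (x + s *: (t *: e)) (t *: e) g (t * dg (x + s *: (t *: e))).
  move=> /andP[s0 s1]; apply: is_deriveZdir.
  have [] // := Hr (x + s *: (t *: e)); rewrite scalerA; apply: Hd.
  by rewrite normrM !ger0_norm// ?ltW// (le_lt_trans _ td)// ler_piMl// ltW.
have [s /andP[s0 s1] E] := @MVT_dir _ (fun y => t * dg y) _ _ D.
have st0 : 0 < s * t by rewrite mulr_gt0.
have : 0 < (s * t)^-1 * dg (x + s *: (t *: e)).
  have := Hd' (s * t); rewrite -ball_normE /= sub0r normrN gtr0_norm//.
  have std : s * t < d' by rewrite (le_lt_trans _ td')// ler_piMl// ltW.
  move=> /(_ std); rewrite gt_eqF// => /(_ isT); rewrite subr0 scalerA (addrC _ x).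
  by rewrite ltr_distl => /andP[_]; rewrite ltrDr.
rewrite pmulr_rgt0 ?invr_gt0// => dpos.
have : g (x + t *: e) <= g x.
  by have [] := Hr (x + t *: e) (Hd t _); rewrite ?gtr0_norm.
by apply/negP; rewrite -ltNge -subr_gt0 E mulr_gt0.
Qed.

End LineCalculus.

(** * Gradients of functions of several variables *)

Section Gateaux.
Variables (R : realType) (n : nat).
Notation V := 'rV[R]_n.
Implicit Types (g h : V -> R) (x y e : V) (A : set V) (L : 'I_n -> R).

(* [L] is the Gateaux gradient of [g] at [x]. *)
Definition gd g x L := forall e, is_derive x e g (\sum_(i < n) L i * e 0 i).

Lemma gd_ext g x L L' : gd g x L -> L =1 L' -> gd g x L'.
Proof.
move=> H E e; apply: is_derive_eq (H e) _.
by apply: eq_bigr => i _; rewrite E.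
Qed.

Lemma gd_near g h x L : (\forall y \near x, g y = h y) -> gd g x L -> gd h x L.
Proof. by move=> H Hg e; apply: near_eq_is_derive (Hg e). Qed.

Lemma sum_evec L i : \sum_(j < n) L j * evec R i 0 j = L i.
Proof.
rewrite (bigD1 i)//= /evec mxE !eqxx mulr1 big1 ?addr0// => j ji.
by rewrite mxE (negbTE ji) andbF mulr0.
Qed.

Lemma gd_is_derive g x L i : gd g x L -> is_derive x (evec R i) g (L i).
Proof. by move=> /(_ (evec R i)); rewrite sum_evec. Qed.

Lemma gd_partial g x L i : gd g x L -> partial i g x = L i.
Proof. by move=> /(@gd_is_derive _ _ _ i)[]. Qed.

Lemma gd_unique g x L L' : gd g x L -> gd g x L' -> L =1 L'.
Proof. by move=> H H' i; rewrite -(gd_partial i H) (gd_partial i H'). Qed.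

Lemma gd_cst (k : R) x : gd (fun=> k) x (fun=> 0).
Proof.
move=> e; apply: is_derive_eq (is_derive_cst _ _ _) _.
by rewrite big1// => i _; rewrite mul0r.
Qed.

Lemma gd_coord x i : gd (fun y => y 0 i) x (fun j => (j == i)%:R).
Proof.
move=> e; have -> : \sum_(j < n) (j == i)%:R * e 0 j = e 0 i.
  by rewrite (bigD1 i)//= eqxx mul1r big1 ?addr0// => j /negbTE ->; rewrite mul0r.
apply/is_derive_line0.
rewrite (_ : (fun s => _) = cst (x 0 i) + (e 0 i) \*: (id : R -> R)); last first.
  by apply/funext => s; rewrite !mxE [RHS]/GRing.add /= mulrC.
apply: is_derive_eq.
by rewrite add0r [_ *: _]mulr1.
Qed.

Lemma gdD g h x L L' : gd g x L -> gd h x L' ->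
  gd (fun y => g y + h y) x (fun i => L i + L' i).
Proof.
move=> Hg Hh e; apply: is_derive_eq (is_deriveD (Hg e) (Hh e)) _.
by rewrite -big_split; apply: eq_bigr => i _; rewrite mulrDl.
Qed.

Lemma gdM g h x L L' : gd g x L -> gd h x L' ->
  gd (fun y => g y * h y) x (fun i => g x * L' i + h x * L i).
Proof.
move=> Hg Hh e; apply: is_derive_eq (is_deriveM (Hg e) (Hh e)) _.
rewrite !scaler_sumr -big_split; apply: eq_bigr => i _ /=.
by rewrite /GRing.scale /=; ring.
Qed.

Lemma gdZ (k : R) h x L : gd h x L -> gd (fun y => k * h y) x (fun i => k * L i).
Proof.
move=> H; apply: gd_ext (gdM (gd_cst k x) H) _ => i /=.
by rewrite mulr0 addr0.
Qed.

Lemma gdB g h x L L' : gd g x L -> gd h x L' ->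
  gd (fun y => g y - h y) x (fun i => L i - L' i).
Proof.
move=> Hg Hh e; apply: is_derive_eq (is_deriveB (Hg e) (Hh e)) _.
by rewrite -sumrB; apply: eq_bigr => i _; rewrite mulrBl.
Qed.

Lemma gd_sum m (h : 'I_m -> V -> R) x (L : 'I_m -> 'I_n -> R) :
  (forall k, gd (h k) x (L k)) ->
  gd (fun y => \sum_(k < m) h k y) x (fun i => \sum_(k < m) L k i).
Proof.
move=> H e; have := is_derive_sum (fun k => H k e) => D.
rewrite (_ : (fun y => _) = \sum_(k < m) h k); last by apply/funext => y; rewrite fct_sumE.
apply: is_derive_eq D _; rewrite exchange_big; apply: eq_bigr => i _.
by rewrite mulr_suml.
Qed.

Lemma gd_comp g (h : R -> R) x L (d : R) : is_derive (g x) 1 h d -> gd g x L ->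
  gd (fun y => h (g y)) x (fun i => d * L i).
Proof.
move=> Hh Hg e; apply: is_derive_eq (is_derive_compR Hh (Hg e)) _.
by rewrite mulr_sumr; apply: eq_bigr => i _; rewrite mulrA.
Qed.

Lemma Ck_S k A g : Ck k.+1 A g -> Ck k A g.
Proof.
elim: k g => [|k IH] g; first by case.
by move=> [H1 [H2 H3]]; split=> //; split=> // i; apply: IH.
Qed.

Lemma Ck_partial k A g i : Ck k.+1 A g -> Ck k A (partial i g).
Proof. by case: k => [|k] [_ [_ H]]; exact: H. Qed.

Lemma Ck_continuous k A g x : Ck k A g -> A x -> {for x, continuous g}.
Proof. by case: k => [H|k [H _]] Ax; exact: H. Qed.

Lemma Ck_derivable k A g x i : Ck k.+1 A g -> A x ->
  is_derive x (evec R i) g (partial i g x).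
Proof. by case=> _ [H _] Ax; apply/derivableP/H. Qed.

Lemma open_near A x : open A -> A x -> \forall y \near x, A y.
Proof. by move=> oA Ax; apply: open_nbhs_nbhs. Qed.

(** Basis directions are added one at a time by [is_deriveD_dir]. Gateaux gradients suffice
    throughout, since only sums, products and compositions with functions of one variable are
    differentiated. *)
Lemma C1_gd k A g x : open A -> Ck k.+1 A g -> A x ->
  gd g x (fun i => partial i g x).
Proof.
move=> oA cg Ax e.
suff H (s : seq 'I_n) : is_derive x (\sum_(i <- s) e 0 i *: evec R i) g
    (\sum_(i <- s) partial i g x * e 0 i).
  by move: (H (index_enum _)); rewrite -row_sum_delta.
elim: s => [|i s IH]; first by rewrite !big_nil; exact: is_derive0.
rewrite !big_cons addrC [X in is_derive _ _ _ X]addrC.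
apply: (is_deriveD_dir (db := fun y => partial i g y * e 0 i)) => //.
- near=> y; rewrite mulrC; apply: is_deriveZdir; apply: (Ck_derivable _ cg).
  by near: y; exact: open_near.
- apply: continuousM; last exact: cst_continuous.
  exact: Ck_continuous (Ck_partial i cg) Ax.
Unshelve. all: by end_near. Qed.

Lemma partialC k A g x i j : open A -> Ck k.+2 A g -> A x ->
  partial i (partial j g) x = partial j (partial i g) x.
Proof.
move=> oA cg Ax.
apply: (@derive_comm R V g (partial j g) (partial i g) _ _ x (evec R j) (evec R i)).
- near=> y; apply: (Ck_derivable _ cg); by near: y; exact: open_near.
- near=> y; apply: (Ck_derivable _ cg); by near: y; exact: open_near.
- near=> y; apply: (Ck_derivable _ (Ck_partial j cg)); by near: y; exact: open_near.
- near=> y; apply: (Ck_derivable _ (Ck_partial i cg)); by near: y; exact: open_near.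
- exact: Ck_continuous (Ck_partial i (Ck_partial j cg)) Ax.
- exact: Ck_continuous (Ck_partial j (Ck_partial i cg)) Ax.
Unshelve. all: by end_near. Qed.

Lemma gd_local_max g (L : V -> 'I_n -> R) (M : 'I_n -> 'I_n -> R) x :
  (\forall y \near x, gd g y (L y)) -> (\forall y \near x, g y <= g x) ->
  (forall i, gd (L^~ i) x (M i)) ->
  (forall i, L x i = 0) /\
  (forall e : V, \sum_(i < n) \sum_(j < n) M i j * e 0 i * e 0 j <= 0).
Proof.
move=> H1 H2 H3; split.
  move=> i; apply: (local_max_derive (e := evec R i) (dg := L^~ i) _ H2).
  by near=> y; apply: gd_is_derive; near: y.
move=> e; apply: (local_max_derive2 (dg := fun y => \sum_(i < n) L y i * e 0 i) (e := e) _ H2).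
  by near=> y; have : gd g y (L y) by [near: y|exact].
have D i : gd (fun y => L y i * e 0 i) x (fun j => M i j * e 0 i).
  apply: gd_ext (gdM (H3 i) (gd_cst (e 0 i) x)) _ => j /=.
  by rewrite mulr0 add0r mulrC.
apply: is_derive_eq (gd_sum D e) _.
rewrite exchange_big; apply: eq_bigr => j _ /=; rewrite mulr_suml.
by rewrite big_mkcond.
Unshelve. all: by end_near. Qed.

End Gateaux.

(** * Quadratic forms *)

Section Forms.
Variables (R : realType) (n : nat).
Implicit Types (v w : 'I_n -> R) (M N : 'I_n -> 'I_n -> R).

Definition ip v w : R := \sum_(i < n) v i * w i.
Definition mv M v : 'I_n -> R := fun i => \sum_(j < n) M i j * v j.
Definition tr M : R := \sum_(i < n) M i i.
Definition qf M v : R := \sum_(i < n) \sum_(j < n) M i j * v i * v j.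
Definition fr M N : R := \sum_(i < n) \sum_(j < n) M i j * N i j.

Lemma ipC v w : ip v w = ip w v.
Proof. by apply: eq_bigr => i _; rewrite mulrC. Qed.

Lemma ip_ge0 v : 0 <= ip v v.
Proof. by apply: sumr_ge0 => i _; rewrite -expr2 sqr_ge0. Qed.

Lemma ipZl k v w : ip (fun i => k * v i) w = k * ip v w.
Proof. by rewrite /ip mulr_sumr; apply: eq_bigr => i _; rewrite mulrA. Qed.

Lemma ipDl v v' w : ip (fun i => v i + v' i) w = ip v w + ip v' w.
Proof. by rewrite /ip -big_split; apply: eq_bigr => i _; rewrite mulrDl. Qed.

Lemma ipZr k v w : ip w (fun i => k * v i) = k * ip w v.
Proof. by rewrite ipC ipZl ipC. Qed.

Lemma ipDr v v' w : ip w (fun i => v i + v' i) = ip w v + ip w v'.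
Proof. by rewrite ipC ipDl !(ipC w). Qed.

Lemma ip_comb4 (A B C D : R) a b c d v :
  (forall k, A * a k + B * b k + C * c k + D * d k = 0) ->
  A * ip a v + B * ip b v + C * ip c v + D * ip d v = 0.
Proof.
move=> H; rewrite -!ipZl -!ipDl /ip big1// => k _.
by rewrite H mul0r.
Qed.

Lemma ip_CauchySchwarz v w : ip v w ^+ 2 <= ip v v * ip w w.
Proof.
have [w0|w0] := eqVneq (ip w w) 0.
  have wi i : w i = 0.
    apply/eqP; rewrite -sqrf_eq0 expr2; apply/eqP.
    by apply: (psumr_eq0P _ w0) => // j _; rewrite -expr2 sqr_ge0.
  have -> : ip v w = 0 by rewrite /ip big1// => i _; rewrite wi mulr0.
  by rewrite w0 mulr0 expr0n.
have w1 : 0 < ip w w by rewrite lt_neqAle eq_sym w0 ip_ge0.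
have := ip_ge0 (fun i => v i + (- (ip v w / ip w w)) * w i).
rewrite ipDl !ipDr !ipZl !ipZr (ipC w v) -(ler_pM2r w1) mul0r.
have -> : (ip v v + - (ip v w / ip w w) * ip v w + (- (ip v w / ip w w) * ip v w +
  - (ip v w / ip w w) * (- (ip v w / ip w w) * ip w w))) * ip w w =
  ip v v * ip w w - ip v w ^+ 2 by field.
by rewrite subr_ge0.
Qed.

Lemma qfE M v : qf M v = ip v (mv M v).
Proof.
apply: eq_bigr => i _; rewrite mulr_sumr; apply: eq_bigr => j _.
by rewrite mulrCA mulrA.
Qed.

Lemma trD M N : tr (fun i j => M i j + N i j) = tr M + tr N.
Proof. by rewrite /tr big_split. Qed.
Lemma trZ k M : tr (fun i j => k * M i j) = k * tr M.
Proof. by rewrite /tr mulr_sumr. Qed.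
Lemma qfD M N v : qf (fun i j => M i j + N i j) v = qf M v + qf N v.
Proof.
rewrite /qf -big_split; apply: eq_bigr => i _; rewrite -big_split.
by apply: eq_bigr => j _; rewrite !mulrDl.
Qed.
Lemma qfZ k M v : qf (fun i j => k * M i j) v = k * qf M v.
Proof.
rewrite /qf mulr_sumr; apply: eq_bigr => i _; rewrite mulr_sumr.
by apply: eq_bigr => j _; rewrite !mulrA.
Qed.
Lemma trB M N : tr (fun i j => M i j - N i j) = tr M - tr N.
Proof. by rewrite /tr sumrB. Qed.
Lemma qfB M N v : qf (fun i j => M i j - N i j) v = qf M v - qf N v.
Proof.
rewrite /qf -sumrB; apply: eq_bigr => i _; rewrite -sumrB.
by apply: eq_bigr => j _; rewrite !mulrBl.
Qed.
Lemma tr_outer w w' : tr (fun i j => w i * w' j) = ip w w'.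
Proof. by []. Qed.
Lemma qf_outer w w' v : qf (fun i j => w i * w' j) v = ip w v * ip w' v.
Proof.
rewrite /qf /ip mulr_suml; apply: eq_bigr => i _; rewrite mulr_sumr.
by apply: eq_bigr => j _; ring.
Qed.

Lemma tr_ext M N : (forall i j, M i j = N i j) -> tr M = tr N.
Proof. by move=> E; apply: eq_bigr => i _. Qed.
Lemma qf_ext M N v : (forall i j, M i j = N i j) -> qf M v = qf N v.
Proof. by move=> E; apply: eq_bigr => i _; apply: eq_bigr => j _; rewrite E. Qed.

Lemma frDl M M' N : fr (fun i j => M i j + M' i j) N = fr M N + fr M' N.
Proof.
rewrite /fr -big_split; apply: eq_bigr => i _; rewrite -big_split.
by apply: eq_bigr => j _; rewrite mulrDl.
Qed.
Lemma frZl k M N : fr (fun i j => k * M i j) N = k * fr M N.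
Proof.
rewrite /fr mulr_sumr; apply: eq_bigr => i _; rewrite mulr_sumr.
by apply: eq_bigr => j _; rewrite mulrA.
Qed.
Lemma frC M N : fr M N = fr N M.
Proof. by apply: eq_bigr => i _; apply: eq_bigr => j _; rewrite mulrC. Qed.
Lemma fr_outer M v w : fr M (fun i j => v i * w j) = ip v (mv M w).
Proof.
apply: eq_bigr => i _; rewrite mulr_sumr; apply: eq_bigr => j _.
by rewrite mulrCA.
Qed.
Lemma fr_ge0 M : 0 <= fr M M.
Proof.
by apply: sumr_ge0 => i _; apply: sumr_ge0 => j _; rewrite -expr2 sqr_ge0.
Qed.
Lemma fr_eq0 M i j : fr M M = 0 -> M i j = 0.
Proof.
move=> H; apply/eqP; rewrite -sqrf_eq0 expr2; apply/eqP.
have H' : \sum_(j < n) M i j * M i j = 0.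
  apply: (psumr_eq0P _ H) => // k _.
  by apply: sumr_ge0 => l _; rewrite -expr2 sqr_ge0.
by apply: (psumr_eq0P _ H') => // k _; rewrite -expr2 sqr_ge0.
Qed.

(* The part of [M] acting on the hyperplane orthogonal to [v]. *)
Definition tang M v : 'I_n -> 'I_n -> R := fun i j =>
  M i j + (- (ip v v)^-1) * (v i * mv M v j + mv M v i * v j)
  + qf M v / ip v v ^+ 2 * (v i * v j).

Lemma mv_outer v w v' i : mv (fun i j => v i * w j) v' i = v i * ip w v'.
Proof. by rewrite /mv mulr_sumr; apply: eq_bigr => j _; rewrite mulrA. Qed.

(** For symmetric [M], [tang M v] is [P M P] with [P] the orthogonal projection that kills [v]. The
    right-hand side is the last bracket of [p_function_scalar], recognised here as a sum of
    squares. *)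
Lemma fr_tang M v : (forall i j, M i j = M j i) -> ip v v != 0 ->
  fr (tang M v) (tang M v) =
  fr M M - 2 * ip (mv M v) (mv M v) / ip v v + qf M v ^+ 2 / ip v v ^+ 2.
Proof.
move=> sM v0; set w := mv M v; set g := ip v v; set a := qf M v.
have mvT v1 v2 : ip v1 (mv M v2) = ip v2 (mv M v1).
  rewrite /ip /mv; under eq_bigr do rewrite mulr_sumr.
  under [RHS]eq_bigr do rewrite mulr_sumr.
  rewrite exchange_big; apply: eq_bigr => i _; apply: eq_bigr => j _.
  by rewrite sM; ring.
have aw : ip v w = a by rewrite /a qfE.
have E N : fr (tang M v) N = fr M N + (- g^-1) * (fr (fun i j => v i * w j) N +
   fr (fun i j => w i * v j) N) + a / g ^+ 2 * fr (fun i j => v i * v j) N.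
  by rewrite frDl frDl frZl frZl frDl.
have oo v1 v2 v3 v4 : fr (fun i j => v1 i * v2 j) (fun i j => v3 i * v4 j) =
    ip v1 v3 * ip v2 v4.
  rewrite fr_outer /ip mulr_suml; apply: eq_bigr => i _.
  by rewrite mv_outer /ip; ring.
rewrite E (frC M) E ![fr _ (tang M v)]frC !E !oo !(frC _ M) !fr_outer.
rewrite (mvT v w) -/w (ipC w v) aw -/g !(mvT w v) -/w.
by field.
Qed.

Lemma qf_sqr M v : (forall i j, M i j = M j i) ->
  qf (fun i j => mv M (M j) i) v = ip (mv M v) (mv M v).
Proof.
move=> sM; transitivity (\sum_(i < n) \sum_(j < n) \sum_(k < n)
    (M k i * v i) * (M k j * v j)).
  apply: eq_bigr => i _; apply: eq_bigr => j _; rewrite /mv !mulr_suml.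
  by apply: eq_bigr => k _; rewrite (sM i k) (sM j k); ring.
under eq_bigr do rewrite exchange_big.
rewrite exchange_big; apply: eq_bigr => k _ /=.
by rewrite /mv mulr_suml; apply: eq_bigr => i _; rewrite mulr_sumr.
Qed.

Lemma tr_comb (P c ph s s' : R) A B H w v :
  tr (fun k l => P * (ph * (A k l + B k l) + c * (w k * w l)) + s * H k l + s' * (v k * v l)) =
  P * (ph * (tr A + tr B) + c * ip w w) + s * tr H + s' * ip v v.
Proof. by rewrite !trD !trZ !trD !trZ !trD !tr_outer. Qed.

Lemma qf_comb (P c ph s s' : R) A B H w v z :
  qf (fun k l => P * (ph * (A k l + B k l) + c * (w k * w l)) + s * H k l + s' * (v k * v l)) z =
  P * (ph * (qf A z + qf B z) + c * (ip w z * ip w z)) + s * qf H z + s' * (ip v z * ip v z).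
Proof. by rewrite !qfD !qfZ !qfD !qfZ !qfD !qf_outer. Qed.

(** The summand is the [k]-th derivative of [qf M v], as the product rule delivers it, when [M] is
    the derivative of [v] and [T] that of [M]. *)
Lemma ip_dqf M (T : 'I_n -> 'I_n -> 'I_n -> R) v : (forall i j, M i j = M j i) ->
  ip (fun k => \sum_(i < n) \sum_(j < n)
        (M i j * v i * M j k + v j * (M i j * M i k + v i * T i j k))) v =
  2 * ip (mv M v) (mv M v) + qf (fun i j => ip (T i j) v) v.
Proof.
move=> sM; transitivity (\sum_(i < n) \sum_(j < n) (M i j * v i * mv M v j +
   (v j * M i j * mv M v i + ip (T i j) v * v i * v j))).
  rewrite /ip; under eq_bigr do rewrite mulr_suml.
  rewrite exchange_big; apply: eq_bigr => i _.
  under eq_bigr do rewrite mulr_suml.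
  rewrite exchange_big; apply: eq_bigr => j _ /=.
  rewrite /mv !mulr_sumr !mulr_suml -!big_split; apply: eq_bigr => k _ /=; ring.
under eq_bigr do rewrite !big_split /=.
rewrite !big_split /= mulr_natl mulr2n -addrA; congr (_ + (_ + _)).
- rewrite /ip exchange_big; apply: eq_bigr => j _; rewrite -mulr_suml; congr (_ * _).
  by rewrite /mv; apply: eq_bigr => i _; rewrite sM.
- rewrite /ip; apply: eq_bigr => j _; rewrite -mulr_suml; congr (_ * _).
  by rewrite /mv; apply: eq_bigr => i _; rewrite mulrC.
Qed.

Lemma ip_dtr (T : 'I_n -> 'I_n -> 'I_n -> R) v :
  ip (fun k => \sum_(i < n) T i i k) v = tr (fun i j => ip (T i j) v).
Proof.
rewrite /ip; under eq_bigr do rewrite mulr_suml.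
by rewrite exchange_big.
Qed.

(** Ellipticity for every [p > 1]: the expression is the trace of [M] over the orthogonal of [v]
    plus [p - 1] times its value in the unit direction of [v]. The first part is nonpositive by
    testing [M] on the projections of the basis vectors. *)
Lemma qf_psd_trace M v (p : R) : 1 < p -> ip v v != 0 ->
  (forall e : 'rV[R]_n, qf M (fun i => e 0 i) <= 0) ->
  tr M + (p - 2) / ip v v * qf M v <= 0.
Proof.
move=> p1 v0 H; set g := ip v v.
have g0 : 0 < g by rewrite lt_neqAle eq_sym v0 ip_ge0.
have Hv : qf M v <= 0.
  by have := H (\row_i v i); congr (_ <= _); apply: eq_bigr => i _; apply: eq_bigr => j _; rewrite !mxE.
have Ht : tr M - qf M v / g <= 0.
  suff <- : \sum_(k < n) qf M (fun i => (\row_i ((i == k)%:R - v k / g * v i)) 0 i) =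
     tr M - qf M v / g by apply: sumr_le0 => k _; exact: H.
  rewrite /qf exchange_big mulr_suml -sumrB; apply: eq_bigr => i _ /=.
  rewrite exchange_big /=.
  transitivity (\sum_(j < n) (M i j * (i == j)%:R - M i j * v i * v j / g)); last first.
    rewrite sumrB -mulr_suml; congr (_ - _).
    rewrite (bigD1 i)//= eqxx mulr1 big1 ?addr0// => j /negbTE ji.
    by rewrite eq_sym ji mulr0.
  apply: eq_bigr => j _.
  transitivity (M i j * \sum_(k < n) ((i == k)%:R * (j == k)%:R
     - (j == k)%:R * (v k / g * v i) - (i == k)%:R * (v k / g * v j) +
     v k * v k * (v i / g * (v j / g)))).
    by rewrite mulr_sumr; apply: eq_bigr => k _; rewrite !mxE; ring.
  rewrite big_split /= sumrB sumrB -mulr_suml -/(ip v v) -/g.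
  have dl (h : 'I_n -> R) l : \sum_(k < n) (l == k)%:R * h k = h l.
    rewrite (bigD1 l)//= eqxx mul1r big1 ?addr0// => k /negbTE kl.
    by rewrite eq_sym kl mul0r.
  rewrite !dl [i == j]eq_sym; field; exact: v0.
have : tr M + (p - 2) / g * qf M v = (tr M - qf M v / g) + (p - 1) / g * qf M v.
  by field; exact: v0.
move=> ->; have : (p - 1) / g * qf M v <= 0.
  by rewrite mulr_ge0_le0// divr_ge0 ?ltW//; lra.
by lra.
Qed.

(* The letters stand for [ph = |v|^(p-2)], [g = |v|^2], [a = v.Hv], [b = |Hv|^2],
   [N = |H|^2], [S = tr H], where [v] and [H] are the gradient and the Hessian of [u];
   [t1] and [t2] are the contractions of the third derivatives of [u] with [v].  The two
   hypotheses are the equation and its derivative in the direction [v]. *)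
Lemma p_function_scalar (p ph g a b N S f f' t1 t2 : R) :
  1 < p -> 0 < ph -> 0 < g ->
  ph * S + (p - 2) * (ph / g * a) + f = 0 ->
  (p - 2) * ph / g * a * S + ph * t1 + (p - 2) * ((p - 4) * ph / g ^+ 2 * a * a +
     ph / g * (2 * b + t2)) + f' * g = 0 ->
  let q := ((p - 1) * ph * a + f * g) / g in
  let tt := ((p - 1) ^+ 2 * ph ^+ 2 * b + 2 * (p - 1) * ph * f * a + f ^+ 2 * g) / g
     - q ^+ 2 in
  ph * ((p - 1) * (ph * (t1 + N) + (p - 2) * ph / g * b) + f * S + f' * g
    + (p - 2) / g * ((p - 1) * (ph * (t2 + b) + (p - 2) * ph / g * a ^+ 2)
       + f * a + f' * g ^+ 2)) =
  (p - 1) * q ^+ 2 + 2 / (p - 1) * tt - p * f * q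
  + (p - 1) * ph ^+ 2 * (N - 2 * b / g + a ^+ 2 / g ^+ 2).
Proof.
move=> p1 ph0 g0 E0 E1 q tt; rewrite /tt /q.
(* The two hypotheses eliminate [f] and [t1]; what remains is an identity of rational functions. *)
have fE : f = - (ph * S + (p - 2) * (ph / g * a)) by lra.
have tE : t1 = - ((p - 2) * ph / g * a * S + (p - 2) * ((p - 4) * ph / g ^+ 2 * a * a +
     ph / g * (2 * b + t2)) + f' * g) / ph.
  have ph1 : ph != 0 by rewrite gt_eqF.
  apply: (mulIf ph1).
  by rewrite divfK ?gt_eqF//; lra.
rewrite tE fE; field.
by rewrite !gt_eqF// subr_gt0.
Qed.

End Forms.

(** * The gradient at the boundary *)

Section Paths.
Variables (R : realType) (n : nat).
Notation V := 'rV[R]_n.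
Implicit Types (x e y : V) (A : set V).

Lemma near_line x e (t : R) (P : set V) :
  (\forall z \near x + t *: e, P z) -> \forall s \near t, P (x + s *: e).
Proof.
move=> /near_ex_ball[r r0 Hr]; have [d d0 Hd] := ball_lin (x + t *: e) e r0.
apply/nbhs_ballP; exists d => //= s; rewrite /ball /= => st.
have -> : x + s *: e = x + t *: e + (s - t) *: e by rewrite -addrA -scalerDl subrKC.
by apply: Hr; apply: Hd; rewrite distrC.
Qed.

Lemma path_continuous A (g : V -> R) x e (a b : R) :
  {within A, continuous g} -> (forall t, a <= t <= b -> A (x + t *: e)) ->
  {within `[a, b], continuous (fun t : R => g (x + t *: e))}.
Proof.
move=> wg H; apply/subspace_continuousP => t /=; rewrite in_itv /= => tab W nW.
move/subspace_continuousP: wg => /(_ _ (H _ tab)) /(_ _ nW).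
rewrite /nbhs /= /within /= => /(@near_line _ _ _ _) h.
apply: filterS h => s /= h; rewrite in_itv /= => sab; exact: h (H _ sab).
Qed.

Lemma dotvE (a b : V) : dotv a b = ip (fun i => a 0 i) (fun i => b 0 i).
Proof. by []. Qed.

Lemma dotvC (a b : V) : dotv a b = dotv b a.
Proof. exact: ipC. Qed.

Lemma dotvDr (a b c : V) : dotv a (b + c) = dotv a b + dotv a c.
Proof. by rewrite !dotvE -ipDr; apply: eq_bigr => i _; rewrite mxE. Qed.

Lemma dotvZr (a b : V) (k : R) : dotv a (k *: b) = k * dotv a b.
Proof. by rewrite !dotvE -ipZr; apply: eq_bigr => i _; rewrite mxE. Qed.

Lemma dotvBr (a b c : V) : dotv a (b - c) = dotv a b - dotv a c.
Proof. by rewrite dotvDr -scaleN1r dotvZr mulN1r. Qed.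

Lemma dotvv_ge0 (a : V) : 0 <= dotv a a. Proof. exact: ip_ge0. Qed.

Lemma dotvv_eq0 (a : V) : (dotv a a == 0) = (a == 0).
Proof.
apply/eqP/eqP => [H|->]; last by rewrite /dotv big1// => i _; rewrite mxE mul0r.
apply/rowP => i; rewrite mxE; apply/eqP; rewrite -sqrf_eq0 expr2; apply/eqP.
by apply: (psumr_eq0P _ H) => // j _; rewrite -expr2 sqr_ge0.
Qed.

Lemma enorm_powR (a : V) (q : R) : enorm a `^ q = dotv a a `^ (q / 2).
Proof. by rewrite /enorm -powR12_sqrt ?dotvv_ge0// -powRrM mulrC. Qed.

Lemma cvg_dotvv (T : Type) (B : set_system T) {FB : Filter B} (h : T -> V) (a : V) :
  h z @[z --> B] --> a -> dotv (h z) (h z) @[z --> B] --> dotv a a.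
Proof.
move=> ha; apply: cvg_sumr => i.
have hi : (h z) 0 i @[z --> B] --> a 0 i.
  exact: (cvg_comp _ _ ha (@coord_continuous_at R n a i)).
exact: cvgM.
Qed.

Lemma cvg_dotvr (T : Type) (B : set_system T) {FB : Filter B} (h : T -> V) (a e : V) :
  h z @[z --> B] --> a -> dotv (h z) e @[z --> B] --> dotv a e.
Proof.
move=> ha; apply: cvg_sumr => i.
have hi : (h z) 0 i @[z --> B] --> a 0 i.
  exact: (cvg_comp _ _ ha (@coord_continuous_at R n a i)).
by apply: cvgM => //; exact: cvg_cst.
Qed.

(** On the closure [rho x <= 0], because [rho] is continuous and [O] is the set [rho < 0] near [x].
    A negative directional derivative then makes [rho] negative just after [x] along [e]. *)
Lemma inward_segment (O : set V) x (r : R) rho e :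
  local_defining O x r rho -> closure O x -> dotv (grad rho x) e < 0 ->
  exists2 d : R, 0 < d & forall h, 0 < h < d -> O (x + h *: e).
Proof.
move=> [r0 [cr [_ Hr]]] clx neg.
have bx : ball x r x by exact: ballxx.
have rle : rho x <= 0.
  rewrite leNgt; apply/negP => rp.
  have cx := Ck_continuous cr bx.
  have P : \forall z \near x, 0 < rho z by have /cvgr_gt := cx; apply.
  have P2 : \forall z \near x, ball x r z by exact: nbhsx_ballx.
  have [z [Oz [z1 z2]]] := clx _ (filterI P P2).
  by move/(Hr _ z2): Oz; rewrite ltNge ltW.
have D := C1_gd (ball_open x r) cr bx; have := D e.
have -> : \sum_(i < n) partial i rho x * e 0 i = dotv (grad rho x) e.
  by apply: eq_bigr => i _; rewrite mxE.
move=> /is_deriveP; set l := dotv _ _.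
have l0 : 0 < - l by rewrite oppr_gt0.
move=> /cvgrPdist_lt /(_ _ l0) /= /(@near_ex_ball R R^o)[d' d'0 Hd'].
have [d d0 Hd] := ball_lin x e r0.
exists (Num.min d d'); first by rewrite lt_min d0.
move=> h /andP[h0]; rewrite lt_min => /andP[hd hd'].
have bh : ball x r (x + h *: e) by apply: Hd; rewrite gtr0_norm.
apply/(Hr _ bh); apply: lt_le_trans rle.
have := Hd' h; rewrite -ball_normE /= sub0r normrN gtr0_norm// gt_eqF//.
move=> /(_ hd' isT); rewrite ltr_distl => /andP[h1 _].
rewrite addrC -subr_lt0 -(pmulr_rlt0 _ (_ : 0 < h^-1)) ?invr_gt0//.
have : h^-1 * (rho (h *: e + x) - rho x) - - l < l := h1.
by move: (h^-1 * _) => q; lra.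
Qed.

Section BoundaryGradient.
Variables (O : set V) (u : V -> R) (G : V -> V).
Hypothesis oO : open O.
Hypothesis cu : Ck 1 O u.
Hypothesis wu : {within closure O, continuous u}.
Hypothesis wG : {within closure O, continuous G}.
Hypothesis GO : forall x, O x -> G x = grad u x.
Hypothesis u_gt0 : forall x, O x -> 0 < u x.
Hypothesis ub : forall x, boundary_of O x -> u x = 0.

(** Otherwise continuity keeps [G . e] negative on the closure near [x], and [u], starting from [0],
    would decrease along the inward segment. *)
Lemma boundary_gradient_inward x (r : R) rho e : boundary_of O x ->
  local_defining O x r rho -> dotv (grad rho x) e < 0 -> 0 <= dotv (G x) e.
Proof.
move=> [clx nOx] ld neg; rewrite leNgt; apply/negP => Gneg.
have [d d0 Hd] := inward_segment ld clx neg.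
have Ge : \forall z \near x, closure O z -> dotv (G z) e < 0.
  move/subspace_continuousP: wG => /(_ _ clx) /(@cvg_dotvr _ _ _ _ _ e).
  by move=> /cvgr_lt /(_ _ Gneg); rewrite near_withinE.
have [r' r'0 Hr'] := near_ex_ball Ge.
have [d' d'0 Hd'] := ball_lin x e r'0.
pose m := Num.min d d' / 2.
have mm : 0 < Num.min d d' by rewrite lt_min d0.
have m0 : 0 < m by rewrite divr_gt0.
have /andP[md md'] : (m < d) && (m < d') by rewrite -lt_min /m; lra.
have Oin t : 0 < t <= m -> O (x + t *: e).
  by move=> /andP[t0 tm]; apply: Hd; rewrite t0 (le_lt_trans tm).
have clin t : 0 <= t <= m -> closure O (x + t *: e).
  move=> /andP[]; rewrite le_eqVlt => /orP[/eqP <- _|t0 tm].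
    by rewrite scale0r addr0.
  by apply: subset_closure; apply: Oin; rewrite t0.
have C := path_continuous wu clin.
have D (t : R) : t \in `]0, m[ -> is_derive t 1 (fun t => u (x + t *: e))
   (dotv (G (x + t *: e)) e).
  rewrite in_itv /= => /andP[t0 tm].
  have Ot : O (x + t *: e) by apply: Oin; rewrite t0 ltW.
  have E : dotv (G (x + t *: e)) e = \sum_(i < n) partial i u (x + t *: e) * e 0 i.
    by rewrite GO//; apply: eq_bigr => i _; rewrite mxE.
  rewrite E.
  exact: (proj1 (is_derive_line u x e t _) (C1_gd oO cu Ot e)).
have [c] := MVT m0 D C; rewrite in_itv /= => /andP[c0 cm].
rewrite scale0r addr0 (ub (conj clx nOx)) !subr0 => E.
have um : 0 < u (x + m *: e) by apply: u_gt0; apply: Oin; rewrite m0 lexx.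
move: um; rewrite E pmulr_lgt0// ltNge => /negP; apply; apply: ltW.
apply: Hr'; first by apply: Hd'; rewrite gtr0_norm// (lt_trans cm).
by apply: clin; rewrite !ltW.
Qed.

(* Since [u >= 0] vanishes on the boundary, its gradient there has no tangential part. *)
Lemma boundary_gradient_norm x (r : R) rho (k : R) : boundary_of O x ->
  local_defining O x r rho -> 0 <= k ->
  dotv (G x) ((enorm (grad rho x))^-1 *: grad rho x) = - k -> enorm (G x) <= k.
Proof.
move=> bx ld k0; set N := grad rho x; rewrite dotvZr => Gk.
have N0 : N != 0 by case: ld => _ [_ []].
have NN : 0 < dotv N N by rewrite lt_neqAle eq_sym dotvv_eq0 N0 dotvv_ge0.
have eN : enorm N ^+ 2 = dotv N N by rewrite /enorm sqr_sqrtr// dotvv_ge0.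
have eN0 : 0 < enorm N by rewrite sqrtr_gt0.
(* [e] is minus the tangential part of [G x], so [G x . e] is minus the square of its length. The
   directions [e - eta N] are inward for every [eta > 0], and letting [eta] tend to [0] gives
   [0 <= G x . e]. *)
pose c := dotv (G x) N / dotv N N.
pose e := c *: N - G x.
have Ne : dotv N e = 0.
  by rewrite dotvBr dotvZr /c divfK ?gt_eqF// dotvC subrr.
have h (eta : R) : 0 < eta -> 0 <= dotv (G x) e - eta * dotv (G x) N.
  move=> eta0; rewrite -dotvZr -dotvBr.
  apply: (boundary_gradient_inward bx ld).
  by rewrite -/N dotvBr Ne dotvZr sub0r oppr_lt0 mulr_gt0.
have GN : dotv (G x) N = - k * enorm N.
  by rewrite -Gk mulrC mulrA mulfV ?gt_eqF// mul1r.
have ge : 0 <= dotv (G x) e.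
  apply/ler_addgt0Pr => eps eps0.
  have [k00|kn0] := eqVneq k 0.
    have := h 1 ltr01; rewrite GN k00 oppr0 mul0r mulr0 subr0 => h1.
    by rewrite addr_ge0// ltW.
  have kp : 0 < k * enorm N by rewrite mulr_gt0// lt_neqAle eq_sym kn0.
  have := h (eps / (k * enorm N)); rewrite divr_gt0// => /(_ isT).
  by rewrite GN mulNr mulrN opprK divfK// gt_eqF.
have : dotv (G x) (G x) <= k ^+ 2.
  move: ge; rewrite dotvBr dotvZr subr_ge0 /c GN -eN => /le_trans; apply.
  by rewrite le_eqVlt; apply/orP; left; apply/eqP; field; rewrite gt_eqF.
rewrite /enorm => H; rewrite -(@ler_pXn2r _ 2)// ?nnegrE ?sqrtr_ge0//.
by rewrite sqr_sqrtr// dotvv_ge0.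
Qed.

Lemma boundary_P_continuous (p : R) (F : R -> R) : 0 < p -> continuous F ->
  {within closure O, continuous (fun x => (p - 1) / p * enorm (G x) `^ p + F (u x))}.
Proof.
move=> p0 cF; apply/subspace_continuousP => x clx.
have hG : G z @[z --> within (closure O) (nbhs x)] --> G x.
  by move/subspace_continuousP: wG => /(_ _ clx).
have hu : u z @[z --> within (closure O) (nbhs x)] --> u x.
  by move/subspace_continuousP: wu => /(_ _ clx).
apply: cvgD; last exact: (cvg_comp _ _ hu (cF (u x))).
apply: cvgM; first exact: cvg_cst.
rewrite enorm_powR; under eq_fun do rewrite enorm_powR.
apply: cvg_powR; [by rewrite divr_gt0|exact: dotvv_ge0| |exact: cvg_dotvv].
by apply: nearW => z; exact: dotvv_ge0.
Qed.

End BoundaryGradient.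
End Paths.

(** * Connectedness and one-dimensional functions *)

Section Connectedness.
Variables (R : realType) (n : nat).
Notation V := 'rV[R]_n.

Lemma open_nearP (T : topologicalType) (A : set T) :
  (forall x, A x -> \forall y \near x, A y) -> open A.
Proof. by move=> H; rewrite openE => x /H. Qed.

Lemma connected_all (T : topologicalType) (O : set T) (P : T -> Prop) :
  open O -> connected O -> (exists2 x, O x & P x) ->
  (forall x, O x -> P x -> \forall y \near x, P y) ->
  (forall x, O x -> ~ P x -> \forall y \near x, ~ P y) ->
  forall x, O x -> P x.
Proof.
move=> oO cO [x0 Ox0 Px0] H1 H2.
have oN A : open A -> forall x, A x -> \forall y \near x, A y.
  by move=> oA x Ax; apply: open_nbhs_nbhs.
have o1 : open (O `&` [set x | P x]).
  apply: open_nearP => x [Ox Px]; apply: filterI; first exact: oN.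
  exact: H1.
have o2 : open (O `&` [set x | ~ P x]).
  apply: open_nearP => x [Ox Px]; apply: filterI; first exact: oN.
  exact: H2.
have B : O `&` [set x | P x] = O.
  apply: cO.
  - by exists x0.
  - exists (O `&` [set x | P x]) => //.
    by rewrite setIA setIid.
  - exists (~` (O `&` [set x | ~ P x])); first exact: open_closedC.
    apply/seteqP; split => x /= [Ox Px]; split => //.
      by case.
    by apply: contrapT => nP; apply: Px.
by move=> x; rewrite -{1}B => -[].
Qed.

(** Without boundary points [O] would be closed as well as open; on a segment from a point inside to
    a point outside, this contradicts the connectedness of [[0, 1]]. *)
Lemma boundary_nonempty (O : set V) : open O -> O !=set0 -> O <> setT ->
  exists x, boundary_of O x.
Proof.
move=> oO [x Ox] nT; apply: contrapT => nb.
have cl z : closure O z -> O z.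
  by move=> cz; apply: contrapT => nz; apply: nb; exists z; split.
have [y ny] : exists y, ~ O y.
  apply: contrapT => h; apply: nT; apply/seteqP; split => // z _.
  by apply: contrapT => nz; apply: h; exists z.
apply: ny; pose e := y - x.
have -> : y = x + 1 *: e by rewrite scale1r subrKC.
pose B := `[0, 1]%classic `&` [set t : R | O (x + t *: e)].
have oC : open [set t : R | O (x + t *: e)].
  apply: open_nearP => t /= Ot; apply: near_line.
  exact: open_nbhs_nbhs.
have cC : closed [set t : R | O (x + t *: e)].
  rewrite -openC; apply: open_nearP => t /= Ot.
  apply: (@near_line _ _ _ _ _ (~` O)).
  have oc : open (~` O).
    rewrite openC => z /cl; exact.
  exact: open_nbhs_nbhs.
have E : B = `[0, 1]%classic.
  have /connected_intervalP cI : is_interval (`[0 : R, 1]%classic) by exact: interval_is_interval.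
  apply: cI.
  - by exists 0; split; rewrite /= ?in_itv /= ?lexx ?ler01// scale0r addr0.
  - by exists [set t : R | O (x + t *: e)].
  - by exists [set t : R | O (x + t *: e)].
have : B 1 by rewrite E /= in_itv /= lexx ler01.
by case.
Qed.

(** The function [psi^2 exp(-2 L t)] starts at [0] and has a nonpositive derivative. The bound is
    stated with squares because Cauchy-Schwarz delivers it so. *)
Lemma gronwall_zero (psi dpsi : R -> R) (L : R) :
  (forall t : R, 0 <= t <= 1 -> is_derive t (1 : R) psi (dpsi t)) ->
  (forall t, 0 <= t <= 1 -> dpsi t ^+ 2 <= L ^+ 2 * psi t ^+ 2) ->
  0 <= L -> psi 0 = 0 -> psi 1 = 0.
Proof.
move=> D H L0 p0.
pose h t := psi t * psi t * expR (- (2 * L) * t).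
pose dh t := (2 * (psi t * dpsi t) - 2 * L * psi t ^+ 2) * expR (- (2 * L) * t).
have Dh (t : R) : 0 <= t <= 1 -> is_derive t (1 : R) h (dh t).
  move=> t01; have Dt := D _ t01.
  have := is_deriveM (is_deriveM Dt Dt) (is_derive_expRM (- (2 * L)) t) => H'.
  apply: is_derive_eq H' _.
  rewrite /dh /GRing.scale /=; change ((psi * psi) t) with (psi t * psi t).
  by ring.
have c : {within `[0, 1], continuous h}.
  apply: derivable_within_continuous => t; rewrite in_itv /= => t01.
  by have [] := Dh _ t01.
have Dh' (t : R) : t \in `]0, 1[ -> is_derive t 1 h (dh t).
  by rewrite in_itv /= => /andP[? ?]; apply: Dh; rewrite !ltW.
have [t] := MVT ltr01 Dh' c; rewrite in_itv /= => /andP[t0 t1].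
rewrite subr0 mulr1 /h p0 !mul0r subr0 => E.
have t01 : 0 <= t <= 1 by rewrite !ltW.
have : dh t <= 0.
  rewrite /dh; apply: mulr_le0_ge0; last exact: expR_ge0.
  have := H _ t01; rewrite -exprMn => h1.
  have : `|dpsi t| <= L * `|psi t|.
    rewrite -(@ler_pXn2r _ 2)// ?nnegrE ?mulr_ge0//.
    by rewrite exprMn !real_normK ?num_real// -exprMn.
  move=> h2; have : psi t * dpsi t <= L * psi t ^+ 2.
    rewrite (le_trans (ler_norm _))// normrM -(real_normK (num_real (psi t))) expr2.
    by rewrite mulrCA ler_wpM2l.
  by lra.
rewrite -E pmulr_lle0 ?expR_gt0// -expr2 => h1.
by apply/eqP; rewrite -sqrf_eq0 eq_le h1 sqr_ge0.
Qed.

(** As a maximum of [F], the point [u0] is a zero of [f], so [|f s|] is at most a multiple of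
    [|s - u0|] and [|F s|] of its square, which for [|s - u0| < 1] is below the power [p]. *)
Lemma primitive_flat (f F : R -> R) (u0 p : R) : 0 < p -> p <= 2 ->
  (forall s : R, derivable f s 1) -> (forall s : R, is_derive s (1 : R) F (f s)) ->
  (forall s, F s <= 0) -> F u0 = 0 ->
  exists C : R, \forall s \near u0, `|F s| <= C * `|s - u0| `^ p.
Proof.
move=> p0 p2 df dF F0 Fu0.
have f0 : f u0 = 0.
  apply: (@local_max_derive R R^o F f u0 1).
    by near=> y; exact: dF.
  by near=> y; rewrite Fu0.
have /is_deriveP := derivableP (df u0); set l := 'D_1 f u0.
rewrite f0 => /cvgrPdist_lt /(_ _ ltr01) /= /(@near_ex_ball R R^o)[d d0 Hd].
have Hf s : `|s - u0| < d -> `|f s| <= (`|l| + 1) * `|s - u0|.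
  move=> sd; have [->|su] := eqVneq s u0.
    by rewrite f0 subrr normr0 mulr0.
  have su0 : s - u0 != 0 by rewrite subr_eq0.
  have := Hd (s - u0); rewrite -ball_normE /= sub0r normrN => /(_ sd su0).
  rewrite subr0 [_ *: 1]mulr1 subrK [_ *: _]/(_ * _) => h.
  have : `|(s - u0)^-1 * f s| <= `|l| + 1.
    have -> : (s - u0)^-1 * f s = l - (l - (s - u0)^-1 * f s) by ring.
    by rewrite (le_trans (ler_normB _ _))// lerD2l ltW.
  by rewrite normrM normfV mulrC ler_pdivrMr// normr_gt0.
exists (`|l| + 1); near=> s.
have sd : `|s - u0| < d.
  near: s; apply/nbhs_ballP; exists d => //= s; rewrite /ball /= distrC; exact.
have s1 : `|s - u0| < 1.
  near: s; apply/nbhs_ballP; exists 1 => //= s; rewrite /ball /= distrC; exact.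
have D t : 0 <= t <= 1 -> is_derive (u0 + t *: (s - u0) : R^o) (s - u0 : R^o) F
    ((s - u0) * f (u0 + t * (s - u0))).
  move=> _; have := is_deriveZdir (s - u0) (dF (u0 + t * (s - u0))).
  by rewrite [_ *: 1]mulr1.
have [t /andP[t0 t1]] := @MVT_dir R R^o F (fun y => (s - u0) * f y) u0 (s - u0) D.
rewrite subrKC Fu0 subr0 => ->.
have ts : `|u0 + t *: (s - u0) - u0| <= `|s - u0|.
  by rewrite [u0 + _]addrC addrK normrZ gtr0_norm// ler_piMl// ltW.
rewrite normrM; apply: (@le_trans _ _ (`|s - u0| * ((`|l| + 1) * `|s - u0|))).
  rewrite ler_wpM2l// (le_trans (Hf _ _))//; first by rewrite (le_lt_trans ts).
  by rewrite ler_wpM2l// addr_ge0.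
rewrite mulrCA ler_wpM2l// ?addr_ge0// -expr2.
have [s0|s0] := eqVneq `|s - u0| 0.
  by rewrite s0 expr0n /= powR_ge0.
rewrite -powR_mulrn//; apply: ger_powR => //.
by rewrite lt_neqAle eq_sym s0 normr_ge0 ltW.
Unshelve. all: by end_near. Qed.

End Connectedness.

(** * Half-spaces from monotonicity along rays *)

Section HalfSpace.
Variables (R : realType) (n : nat).
Notation V := 'rV[R]_n.
Variables (O : set V) (u : V -> R) (a : V) (s : V -> R).
Hypothesis oO : open O.
Hypothesis wu : {within closure O, continuous u}.
Hypothesis u_gt0 : forall x, O x -> 0 < u x.
Hypothesis ub : forall x, boundary_of O x -> u x = 0.
Hypothesis aa : dotv a a = 1.
Hypothesis s_gt0 : forall x, O x -> 0 < s x.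
Hypothesis du : forall x e, O x -> is_derive x e u (s x * dotv a e).

(** The closing step of a continuation argument: the endpoint is in the closure and [u] is at least
    [u x > 0] there, so it is not a boundary point. *)
Lemma ray_limit x e (t : R) : O x -> 0 <= dotv a e -> 0 <= t ->
  (forall h, 0 <= h < t -> O (x + h *: e)) ->
  O (x + t *: e) /\ u x <= u (x + t *: e).
Proof.
move=> Ox ae; rewrite le_eqVlt => /orP[/eqP <- _|t0 H].
  by rewrite scale0r addr0.
have clt : closure O (x + t *: e).
  move=> W /near_line nW.
  have [d d0 Hd] := @near_ex_ball R R^o _ _ nW.
  pose h := Num.max 0 (t - d / 2).
  have ht : h < t by rewrite gt_max t0 /=; move: d0; lra.
  have h0 : 0 <= h by rewrite le_max lexx.
  exists (x + h *: e); split; first by apply: H; rewrite h0.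
  apply: Hd; rewrite -ball_normE /= gtr0_norm ?subr_gt0//.
  have : t - d / 2 <= h by rewrite le_max lexx orbT.
  by move: d0; lra.
have cl h : 0 <= h <= t -> closure O (x + h *: e).
  move=> /andP[h0]; rewrite le_eqVlt => /orP[/eqP ->//|ht].
  by apply: subset_closure; apply: H; rewrite h0.
have C := path_continuous wu cl.
have D (h : R) : h \in `]0, t[ -> is_derive h (1 : R) (fun h : R => u (x + h *: e))
    (s (x + h *: e) * dotv a e).
  rewrite in_itv /= => /andP[h0 ht].
  have Oh : O (x + h *: e) by apply: H; rewrite ht ltW.
  exact: (proj1 (is_derive_line u x e h _) (du e Oh)).
have [h] := MVT t0 D C; rewrite in_itv /= => /andP[h0 ht].
rewrite scale0r addr0 subr0 => E.
have Oh : O (x + h *: e) by apply: H; rewrite ht ltW.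
have le : u x <= u (x + t *: e).
  by rewrite -subr_ge0 E !mulr_ge0// ltW// s_gt0.
split => //; apply: contrapT => nO.
have := ub (conj clt nO) => u0; move: le; rewrite u0 leNgt => /negP; apply.
exact: u_gt0.
Qed.

Lemma ray_inside x e (t : R) : O x -> 0 <= dotv a e -> 0 <= t ->
  O (x + t *: e) /\ u x <= u (x + t *: e).
Proof.
move=> Ox ae t0.
suff H h : 0 <= h -> O (x + h *: e).
  by apply: ray_limit => // h /andP[h0 _]; exact: H.
move=> h0; apply: contrapT => nO.
(* [inf S] is the exit time of the ray. [ray_limit] puts the exit point inside [O], and openness
   carries the ray beyond it. *)
pose S := [set h : R | 0 <= h /\ ~ O (x + h *: e)].
have hS : has_inf S.
  by split; [exists h|exists 0 => z []].
have i0 : 0 <= inf S by apply: lb_le_inf; [exists h|move=> z []].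
have Hi z : 0 <= z < inf S -> O (x + z *: e).
  move=> /andP[z0 zi]; apply: contrapT => nz.
  move: zi; rewrite ltNge => /negP; apply.
  by apply: ge_inf; [exact: hS.2|split].
have [Oi _] := ray_limit Ox ae i0 Hi.
have := near_line (open_nbhs_nbhs (conj oO Oi)) => /(@near_ex_ball R R^o)[d d0 Hd].
have [z [z0 nz] zi] := inf_adherent d0 hS.
have iz : inf S <= z by apply: ge_inf; [exact: hS.2|split].
apply: nz; apply: Hd; rewrite -ball_normE /= distrC ger0_norm ?subr_ge0//.
by rewrite ltrBlDl.
Qed.

(** Rays from [x] reach every [y] with [a . x <= a . y], so [O] is an upper set for [a . x]. Two
    points on one level reach each other, so [u] takes the same value at both. Openness excludes the
    level [al] itself. *)
Lemma half_space_parallel : O !=set0 -> O <> setT -> half_space O /\ parallel O u.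
Proof.
move=> [x0 Ox0] nT.
have up x y : O x -> dotv a x <= dotv a y -> O y /\ u x <= u y.
  move=> Ox xy; have := @ray_inside x (y - x) 1 Ox.
  by rewrite scale1r subrKC dotvBr subr_ge0 xy; apply.
have [y ny] : exists y, ~ O y.
  apply: contrapT => h; apply: nT; apply/seteqP; split => // z _.
  by apply: contrapT => nz; apply: h; exists z.
pose I := [set dotv a x | x in O].
have lbI : lbound I (dotv a y).
  move=> _ [x Ox <-]; rewrite leNgt; apply/negP => xy.
  by apply: ny; have [] := up _ y Ox (ltW xy).
have hI : has_inf I by split; [exists (dotv a x0); exists x0|exists (dotv a y)].
pose al := inf I.
have OE x : O x <-> al < dotv a x.
  split => [Ox|ax].
    have := @near_line _ _ x a 0 O; rewrite scale0r addr0.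
    move=> /(_ (open_nbhs_nbhs (conj oO Ox))) /(@near_ex_ball R R^o)[d d0 Hd].
    have h : O (x + (- (d / 2)) *: a).
      apply: Hd; rewrite -ball_normE /= sub0r opprK gtr0_norm; move: d0; lra.
    have : al <= dotv a (x + (- (d / 2)) *: a).
      by apply: ge_inf; [exact: hI.2|exists (x + (- (d / 2)) *: a)].
    rewrite dotvDr dotvZr aa mulr1; move: d0; lra.
  have ax0 : 0 < dotv a x - al by rewrite subr_gt0.
  have [_ [z Oz <-]] := inf_adherent ax0 hI; rewrite -/al subrKC => zx.
  by have [] := up z x Oz (ltW zx).
have E : O = [set x | 0 < dotv a (x - al *: a)].
  apply/seteqP; split => x /=; rewrite dotvBr dotvZr aa mulr1 subr_gt0.
    by move/OE.
  by move=> h; apply/OE.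
split.
  exists (al *: a), a; split => //.
  by rewrite -dotvv_eq0 aa oner_eq0.
exists (al *: a), a, (fun t => u (al *: a + t *: a)); split => // x Ox.
set y' := al *: a + _.
have yE : dotv a y' = dotv a x.
  by rewrite /y' !(dotvBr, dotvDr, dotvZr) aa; ring.
have le1 : dotv a x <= dotv a y' by rewrite yE.
have le2 : dotv a y' <= dotv a x by rewrite yE.
have [Oy h1] := up x y' Ox le1; have [_ h2] := up y' x Oy le2.
by apply/eqP; rewrite eq_le h1 h2.
Qed.

End HalfSpace.

(** * The P-function *)

Section PFunction.
Variables (R : realType) (n : nat) (p : R) (Omega : set 'rV[R]_n).
Variables (f F : R -> R) (u : 'rV[R]_n -> R).
Notation V := 'rV[R]_n.
Hypothesis p1 : 1 < p.
Hypothesis oO : open Omega.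
Hypothesis df : forall s : R, derivable f s 1.
Hypothesis dF : forall s : R, is_derive s (1 : R) F (f s).
Hypothesis cu : Ck 3 Omega u.
Hypothesis pde : forall x, Omega x -> plap_eq_at p f u x.

Definition vu (y : V) (i : 'I_n) : R := partial i u y.
Definition Hu (y : V) (i j : 'I_n) : R := partial j (partial i u) y.
Definition Tu (y : V) (i j k : 'I_n) : R := partial k (partial j (partial i u)) y.
(** Powers of the length of the gradient are written as powers of its square [gu], which is
    differentiable everywhere in [Omega]; thus [phu] is [|grad u|^(p-2)]. *)
Definition gu (y : V) : R := ip (vu y) (vu y).
Definition phu (y : V) : R := gu y `^ (p / 2 - 1).
Definition Qu (y : V) : R := (p - 1) / p * enorm (grad u y) `^ p + F (u y).
Definition Q1u (y : V) (k : 'I_n) : R :=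
  (p - 1) * (phu y * mv (Hu y) (vu y) k) + f (u y) * vu y k.

Lemma gu_ge0 y : 0 <= gu y. Proof. exact: ip_ge0. Qed.

Lemma dotv_grad y : dotv (grad u y) (grad u y) = gu y.
Proof. by apply: eq_bigr => i _; rewrite !mxE. Qed.

Lemma enorm_grad y (a : R) : enorm (grad u y) `^ a = gu y `^ (a / 2).
Proof.
by rewrite /enorm dotv_grad -powR12_sqrt ?gu_ge0// -powRrM mulrC.
Qed.

Lemma grad_eq0 y : (grad u y == 0) = (gu y == 0).
Proof.
apply/eqP/eqP => [g0|g0].
  rewrite /gu /ip big1// => i _; have : grad u y 0 i = 0 by rewrite g0 mxE.
  by rewrite mxE /vu => ->; rewrite mul0r.
apply/rowP => i; rewrite !mxE; apply/eqP; rewrite -sqrf_eq0 expr2; apply/eqP.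
by apply: (psumr_eq0P _ g0) => // j _; rewrite -expr2 sqr_ge0.
Qed.

Lemma QuE : Qu = fun y => (p - 1) / p * gu y `^ (p / 2) + F (u y).
Proof. by apply/funext => y; rewrite /Qu enorm_grad. Qed.

Lemma gd_u y : Omega y -> gd u y (vu y).
Proof. by move=> Oy; exact: (C1_gd oO cu Oy). Qed.

Lemma gd_v y i : Omega y -> gd (fun z => vu z i) y (Hu y i).
Proof. by move=> Oy; exact: (C1_gd oO (Ck_partial i cu) Oy). Qed.

Lemma gd_H y i j : Omega y -> gd (fun z => Hu z i j) y (Tu y i j).
Proof. by move=> Oy; exact: (C1_gd oO (Ck_partial j (Ck_partial i cu)) Oy). Qed.

Lemma HuC y i j : Omega y -> Hu y i j = Hu y j i.
Proof. by move=> Oy; exact: (partialC _ _ oO cu Oy). Qed.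

Lemma TuC23 y i j k : Omega y -> Tu y i j k = Tu y i k j.
Proof. by move=> Oy; exact: (partialC _ _ oO (Ck_partial i cu) Oy). Qed.

Lemma gd_g y : Omega y -> gd gu y (fun k => 2 * mv (Hu y) (vu y) k).
Proof.
move=> Oy; apply: gd_ext (gd_sum (fun i => gdM (gd_v i Oy) (gd_v i Oy))) _ => k /=.
rewrite /mv mulr_sumr; apply: eq_bigr => i _.
by rewrite (HuC k i Oy); ring.
Qed.

Lemma gu_continuous y : Omega y -> {for y, continuous gu}.
Proof.
move=> Oy; apply: (@cvg_sumr _ _ (nbhs y)) => i.
by apply: cvgM; exact: Ck_continuous (Ck_partial i cu) Oy.
Qed.

Lemma near_gu y : Omega y -> 0 < gu y -> \forall z \near y, Omega z /\ 0 < gu z.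
Proof.
move=> Oy g0; apply: filterI; first exact: open_near.
by have /cvgr_gt := gu_continuous Oy; apply.
Qed.

Lemma gd_powg y a : Omega y -> 0 < gu y ->
  gd (fun z => gu z `^ a) y (fun k => a * gu y `^ (a - 1) * (2 * mv (Hu y) (vu y) k)).
Proof.
move=> Oy g0; exact: (gd_comp (h := fun t => t `^ a) (is_derive1_powR a g0) (gd_g Oy)).
Qed.

Lemma gd_Q y : Omega y -> 0 < gu y -> gd Qu y (Q1u y).
Proof.
move=> Oy g0; rewrite QuE.
apply: gd_ext (gdD (gdZ _ (gd_powg (p / 2) Oy g0)) (gd_comp (dF _) (gd_u Oy))) _ => k /=.
have p0 : p != 0 by rewrite gt_eqF// (lt_trans ltr01).
by rewrite /Q1u /phu; field.
Qed.

(** The divergence is expanded by the product rule. [near_gu] keeps a whole neighbourhood free of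
    critical points, so [plap_field] stays in its second branch while it is differentiated. *)
Lemma pdeE y : Omega y -> 0 < gu y ->
  phu y * tr (Hu y) + (p - 2) * (gu y `^ (p / 2 - 2) * qf (Hu y) (vu y)) + f (u y) = 0.
Proof.
move=> Oy g0; have [_ E] := pde Oy.
have D i : gd (fun z => plap_field p u z 0 i) y (fun k => phu y * Hu y i k +
    vu y i * ((p / 2 - 1) * gu y `^ (p / 2 - 1 - 1) * (2 * mv (Hu y) (vu y) k))).
  apply: (gd_near _ (gdM (gd_powg (p / 2 - 1) Oy g0) (gd_v i Oy))).
  near=> z; rewrite /plap_field grad_eq0 gt_eqF; last first.
    by have [] : Omega z /\ 0 < gu z by near: z; exact: near_gu.
  by rewrite !mxE enorm_grad; congr (_ `^ _ * _); field.
rewrite -[RHS]E; congr (_ + _).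
under [in RHS]eq_bigr do rewrite -/(partial _ _ _) (gd_partial _ (D _)).
rewrite big_split /= -mulr_sumr; congr (_ + _).
rewrite qfE /ip !mulr_sumr; apply: eq_bigr => i _.
have -> : p / 2 - 1 - 1 = p / 2 - 2 by ring.
by field.
Unshelve. all: by end_near. Qed.

Definition Q2u (y : V) (k l : 'I_n) : R :=
  (p - 1) * (phu y * (mv (Hu y) (Hu y l) k + ip (Tu y k l) (vu y)) +
             (p - 2) * phu y / gu y * (mv (Hu y) (vu y) k * mv (Hu y) (vu y) l)) +
  f (u y) * Hu y k l + derive1 f (u y) * (vu y k * vu y l).

Lemma powg1 y : 0 < gu y -> gu y `^ (p / 2 - 2) = phu y / gu y.
Proof.
move=> g0; rewrite -[in RHS](powRr1 (gu_ge0 y)) /phu -powRB; last by apply/implyP => _; rewrite gt_eqF.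
by congr (_ `^ _); ring.
Qed.

Lemma powg2 y : 0 < gu y -> gu y `^ (p / 2 - 3) = phu y / gu y ^+ 2.
Proof.
move=> g0; rewrite -[in RHS]powR_mulrn ?gu_ge0// /phu -powRB; last by apply/implyP => _; rewrite gt_eqF.
by congr (_ `^ _); ring.
Qed.

Lemma gd_Q1 y k : Omega y -> 0 < gu y -> gd (fun z => Q1u z k) y (Q2u y k).
Proof.
move=> Oy g0.
have Dmv : gd (fun z => mv (Hu z) (vu z) k) y _ :=
  gd_sum (fun j => gdM (gd_H k j Oy) (gd_v j Oy)).
have Df : is_derive (u y) 1 f (derive1 f (u y)).
  by rewrite derive1E; apply/derivableP/df.
apply: gd_ext (gdD (gdZ _ (gdM (gd_powg (p / 2 - 1) Oy g0) Dmv))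
  (gdM (gd_comp Df (gd_u Oy)) (gd_v k Oy))) _ => l /=.
have -> : p / 2 - 1 - 1 = p / 2 - 2 by ring.
rewrite powg1// /Q2u -/(phu y).
have -> : \sum_(j < n) (Hu y k j * Hu y j l + vu y j * Tu y k j l) =
    mv (Hu y) (Hu y l) k + ip (Tu y k l) (vu y).
  rewrite /mv /ip -big_split; apply: eq_bigr => j _ /=.
  by rewrite (HuC j l Oy) (TuC23 k j l Oy) (mulrC (vu y j)).
have : gu y != 0 by rewrite gt_eqF.
move: (mv (Hu y) (Hu y l) k) (ip (Tu y k l) (vu y)) (mv (Hu y) (vu y) k)
  (mv (Hu y) (vu y) l) (gu y) (phu y)
  (f (u y)) (derive1 f (u y)) (vu y k) (vu y l) (Hu y k l).
by move=> a b c d g ph s s' e e' h g1; field.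
Qed.

(** The left-hand side of [pdeE] vanishes near [y], hence so does its gradient; contracted with
    [vu y], this is the second hypothesis of [p_function_scalar]. *)
Lemma pdeE_der y : Omega y -> 0 < gu y ->
  let a := qf (Hu y) (vu y) in
  let w := mv (Hu y) (vu y) in
  let T' i j := ip (Tu y i j) (vu y) in
  (p - 2) * phu y / gu y * a * tr (Hu y) + phu y * tr T' +
  (p - 2) * ((p - 4) * phu y / gu y ^+ 2 * a * a +
     phu y / gu y * (2 * ip w w + qf T' (vu y))) + derive1 f (u y) * gu y = 0.
Proof.
move=> Oy g0 a w T'.
have Df : is_derive (u y) 1 f (derive1 f (u y)).
  by rewrite derive1E; apply/derivableP/df.
have Dtr : gd (fun z => tr (Hu z)) y _ := gd_sum (fun i => gd_H i i Oy).
have Dqf : gd (fun z => qf (Hu z) (vu z)) y _ := gd_sum (fun i => gd_sum (fun j =>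
   gdM (gdM (gd_H i j Oy) (gd_v i Oy)) (gd_v j Oy))).
have DE := gdD (gdD (gdM (gd_powg (p / 2 - 1) Oy g0) Dtr)
  (gdZ (p - 2) (gdM (gd_powg (p / 2 - 2) Oy g0) Dqf))) (gd_comp Df (gd_u Oy)).
have Z : \forall z \near y, gu z `^ (p / 2 - 1) * tr (Hu z) +
    (p - 2) * (gu z `^ (p / 2 - 2) * qf (Hu z) (vu z)) + f (u z) = 0.
  by near=> z; have [] : Omega z /\ 0 < gu z; [near: z; exact: near_gu|exact: pdeE].
have E0 := gd_unique (gd_near Z DE) (gd_cst 0 y).
have c : p / 2 - 2 - 1 = p / 2 - 3 by ring.
have c' : p / 2 - 1 - 1 = p / 2 - 2 by ring.
rewrite c c' powg2// powg1// -/(phu y) in E0.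
have {E0} E0 k : phu y * (\sum_(i < n) Tu y i i k) +
    ((p - 2) * phu y / gu y * tr (Hu y) + (p - 2) * (p - 4) * phu y / gu y ^+ 2 * a) * w k +
    (p - 2) * (phu y / gu y) * (\sum_(i < n) \sum_(j < n)
       (Hu y i j * vu y i * Hu y j k + vu y j * (Hu y i j * Hu y i k + vu y i * Tu y i j k))) +
    derive1 f (u y) * vu y k = 0.
  rewrite -[RHS](E0 k) -/a -/(w k).
  have : gu y != 0 by rewrite gt_eqF.
  move: (gu y) (phu y) (derive1 f (u y)) (vu y k) (w k) a (tr (Hu y)) (\sum_(i < n) Tu y i i k)
    (\sum_(i < n) \sum_(j < n) _) => g ph d v' w' a' t s1 s2 g1.
  by field.
have := ip_comb4 (vu y) E0.
rewrite ip_dtr ip_dqf; last by move=> i j; exact: HuC.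
rewrite -/w -/(gu y) (ipC w) -qfE -/a => E1; rewrite -[RHS]E1 /T'.
move: (gu y) (phu y) (derive1 f (u y)) (a) (tr (Hu y)) (tr (fun i j => _)) (ip w w) (qf (fun i j => _) _).
by move=> g ph d a' t s1 s2 s3; ring.
Unshelve. all: by end_near. Qed.

Lemma p_function_identity y : Omega y -> 0 < gu y ->
  let q := ip (vu y) (Q1u y) / gu y in
  let tt := ip (Q1u y) (Q1u y) / gu y - q ^+ 2 in
  phu y * (tr (Q2u y) + (p - 2) / gu y * qf (Q2u y) (vu y)) =
  (p - 1) * q ^+ 2 + 2 / (p - 1) * tt - p * f (u y) * q +
  (p - 1) * phu y ^+ 2 * fr (tang (Hu y) (vu y)) (tang (Hu y) (vu y)).
Proof.
move=> Oy g0 q tt; have g1 : ip (vu y) (vu y) != 0 by rewrite gt_eqF.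
have sH i j : Hu y i j = Hu y j i by exact: HuC.
set a := qf (Hu y) (vu y); set w := mv (Hu y) (vu y); set b := ip w w.
set T' := fun i j => ip (Tu y i j) (vu y).
have ph0 : 0 < phu y by rewrite powR_gt0.
have qE : ip (vu y) (Q1u y) = (p - 1) * phu y * a + f (u y) * gu y.
  rewrite /Q1u ipDr ipZr ipZr ipZr -qfE mulrA; by [].
have QQ : ip (Q1u y) (Q1u y) = (p - 1) ^+ 2 * phu y ^+ 2 * b +
    2 * (p - 1) * phu y * f (u y) * a + f (u y) ^+ 2 * gu y.
  have wQ : ip w (Q1u y) = (p - 1) * (phu y * b) + f (u y) * a.
    by rewrite /Q1u ipDr !ipZr -/w -/b (ipC w) -qfE.
  rewrite {1}/Q1u ipDl !ipZl wQ qE.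
  move: (phu y) (f (u y)) (gu y) (a) (b) => ? ? ? ? ?; ring.
have E0 := pdeE Oy g0; rewrite powg1// -/a in E0.
have E1 := pdeE_der Oy g0.
have HH := @p_function_scalar R p (phu y) (gu y) a b (fr (Hu y) (Hu y)) (tr (Hu y))
  (f (u y)) (derive1 f (u y)) (tr T') (qf T' (vu y)) p1 ph0 g0 E0 E1.
rewrite /tt /q qE QQ (fr_tang sH g1) -/a -/w -/b -/(gu y) -HH.
have trQ : tr (Q2u y) = (p - 1) * (phu y * (fr (Hu y) (Hu y) + tr T') +
    (p - 2) * phu y / gu y * b) + f (u y) * tr (Hu y) + derive1 f (u y) * gu y.
  exact: tr_comb.
have qfQ : qf (Q2u y) (vu y) = (p - 1) * (phu y * (b + qf T' (vu y)) +
    (p - 2) * phu y / gu y * (a * a)) + f (u y) * a + derive1 f (u y) * (gu y * gu y).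
  have wa : ip w (vu y) = a by rewrite ipC -qfE.
  have bE : b = qf (fun i j => mv (Hu y) (Hu y j) i) (vu y) by rewrite (qf_sqr _ sH).
  by rewrite bE -{1 2}wa; exact: qf_comb.
rewrite trQ qfQ.
move: (phu y) (gu y) (f (u y)) (derive1 f (u y)) (a) (b) (fr _ _) (tr (Hu y)) (tr T')
  (qf T' _) (p - 2).
by move=> *; ring.
Qed.

Lemma phu_gt0 y : 0 < gu y -> 0 < phu y.
Proof. by move=> g0; rewrite powR_gt0. Qed.

(* [Qu] is a viscosity subsolution of the linear equation satisfied by the P-function. *)
Lemma p_function_subsolution y (psi : V -> R) (P1 : V -> 'I_n -> R)
    (P2 : 'I_n -> 'I_n -> R) : Omega y -> 0 < gu y ->
  (\forall z \near y, gd psi z (P1 z)) -> (forall i, gd (P1^~ i) y (P2 i)) ->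
  (\forall z \near y, Qu z - psi z <= Qu y - psi y) ->
  0 <= phu y * (tr P2 + (p - 2) / gu y * qf P2 (vu y)) +
       p * f (u y) * (ip (vu y) (P1 y) / gu y).
Proof.
move=> Oy g0 D1 D2 mx.
have DL : \forall z \near y, gd (fun z => Qu z - psi z) z (fun i => Q1u z i - P1 z i).
  near=> z; apply: gdB; last by near: z.
  by have [] : Omega z /\ 0 < gu z; [near: z; exact: near_gu|exact: gd_Q].
have DM i := gdB (gd_Q1 i Oy g0) (D2 i).
(* The gradients agree at [y], so [q] can be computed from [P1], and the Hessian of [Qu - psi] is
   nonpositive. The other terms of the identity are nonnegative ([tt0] by Cauchy-Schwarz), except
   the drift [- p f q]. *)
have [E H] := gd_local_max DL mx DM.
have {}E : ip (vu y) (P1 y) = ip (vu y) (Q1u y).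
  by apply: eq_bigr => i _; have /eqP := E i; rewrite subr_eq0 => /eqP ->.
have g1 : ip (vu y) (vu y) != 0 by rewrite gt_eqF.
have := qf_psd_trace p1 g1 H; rewrite trB qfB -/(gu y) mulrBr => tle.
have := p_function_identity Oy g0; rewrite /= -E => Id.
set q := ip _ _ / _ in Id *.
have tt0 : 0 <= ip (Q1u y) (Q1u y) / gu y - q ^+ 2.
  have := ip_CauchySchwarz (vu y) (Q1u y); rewrite -E -/(gu y).
  rewrite subr_ge0 ler_pdivlMr// /q expr_div_n => CS.
  have gg : gu y ^+ 2 = gu y * gu y by rewrite expr2.
  rewrite gg invfM mulrA divfK ?gt_eqF// ler_pdivrMr// mulrC; exact: CS.
have ph0 := phu_gt0 g0.
have B1 : 0 <= (p - 1) * phu y ^+ 2 * fr (tang (Hu y) (vu y)) (tang (Hu y) (vu y)).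
  by rewrite mulr_ge0 ?fr_ge0// mulr_ge0 ?sqr_ge0// subr_ge0 ltW.
have B2 : 0 <= 2 / (p - 1) * (ip (Q1u y) (Q1u y) / gu y - q ^+ 2).
  by rewrite mulr_ge0// divr_ge0// subr_ge0 ltW.
have B3 : 0 <= (p - 1) * q ^+ 2 by rewrite mulr_ge0 ?sqr_ge0// subr_ge0 ltW.
have : phu y * (tr (Q2u y) + (p - 2) / gu y * qf (Q2u y) (vu y)) <=
       phu y * (tr P2 + (p - 2) / gu y * qf P2 (vu y)).
  rewrite ler_pM2l//; move: tle.
  by move: (tr _) (tr _) ((p - 2) / gu y * _) (_ * qf (Q2u y) _) => *; lra.
rewrite {}Id; move: B1 B2 B3.
set b1 := (p - 1) * phu y ^+ 2 * _; set b2 := 2 / (p - 1) * _.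
set b3 := (p - 1) * q ^+ 2; set b4 := p * f (u y) * q.
set b5 := phu y * (tr P2 + _).
move: b1 b2 b3 b4 b5 => b1 b2 b3 b4 b5.
by move=> *; lra.
Unshelve. all: by end_near. Qed.

(** With [Qu] constant near [y] the identity leaves only the square of the tangential Hessian, which
    must vanish. In addition [Q1u = 0] makes [vu y] an eigenvector of the Hessian, with eigenvalue
    [la], which removes the mixed entries. *)
Lemma p_function_rigidity y (k : R) : Omega y -> 0 < gu y ->
  (\forall z \near y, Qu z = k) -> forall i j,
  Hu y i j = qf (Hu y) (vu y) / gu y ^+ 2 * (vu y i * vu y j).
Proof.
move=> Oy g0 Qk i j.
have Qk' : \forall z \near y, \forall z' \near z, Qu z' = k by exact: near_join Qk.
have Q1z : \forall z \near y, forall l, Q1u z l = 0.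
  near=> z; have [Oz gz] : Omega z /\ 0 < gu z by near: z; exact: near_gu.
  have Qz : \forall z' \near z, Qu z' = k by near: z; exact: Qk'.
  by move=> l; apply: (gd_unique (gd_near Qz (gd_Q Oz gz)) (gd_cst k z)).
have Q2z l m : Q2u y l m = 0.
  have Z : \forall z \near y, Q1u z l = 0.
    by near=> z; have : forall l, Q1u z l = 0; [near: z|exact].
  exact: (gd_unique (gd_near Z (gd_Q1 l Oy g0)) (gd_cst 0 y)).
have Q1y : forall l, Q1u y l = 0 by exact: nbhs_singleton Q1z.
have := p_function_identity Oy g0 => /=.
have -> : tr (Q2u y) = 0 by rewrite /tr big1.
have -> : qf (Q2u y) (vu y) = 0.
  by rewrite /qf big1// => l _; rewrite big1// => m _; rewrite Q2z !mul0r.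
have -> : ip (vu y) (Q1u y) = 0 by rewrite /ip big1// => l _; rewrite Q1y mulr0.
have -> : ip (Q1u y) (Q1u y) = 0 by rewrite /ip big1// => l _; rewrite Q1y mulr0.
rewrite !mul0r expr0n /= subr0 !mulr0 !addr0 subr0 add0r mulr0 => /esym/eqP.
have ph0 := phu_gt0 g0.
have pp : (p - 1) * phu y ^+ 2 != 0.
  by rewrite mulf_neq0// ?expf_neq0// gt_eqF// subr_gt0.
rewrite mulf_eq0 (negbTE pp) /= => /eqP /(fr_eq0 i j).
set a := qf (Hu y) (vu y); set w := mv (Hu y) (vu y).
pose la := - f (u y) / ((p - 1) * phu y).
have wE l : w l = la * vu y l.
  have := Q1y l; rewrite /Q1u -/w => /eqP; rewrite addr_eq0 => /eqP E.
  have pp' : (p - 1) * phu y != 0 by rewrite mulf_neq0// gt_eqF// subr_gt0.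
  apply: (mulfI pp'); rewrite -mulrA E /la mulrA [_ * (_ / _)]mulrC divfK//.
  by rewrite mulNr.
have aE : a = la * gu y.
  rewrite /a qfE -/w /gu -ipZr; apply: eq_bigr => l _; by rewrite wE.
rewrite /tang -/w -/a -/(gu y) !wE aE.
have : gu y != 0 by rewrite gt_eqF.
move: (gu y) (vu y i) (vu y j) (Hu y i j) => g vi vj h gn0 E.
apply/eqP; rewrite -subr_eq0 -E; apply/eqP.
by field.
Unshelve. all: by end_near. Qed.

(** * Test functions of [u] and of the distance to a point *)

Section Radial.
Variable x1 : V.

Definition rad (y : V) (i : 'I_n) : R := y 0 i - x1 0 i.
(** The squared Euclidean distance is smooth, unlike the sup norm behind [ball]; [rr_norm] and
    [rr_ball] pass from one to the other. *)
Definition rr (y : V) : R := ip (rad y) (rad y).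

Lemma gd_rad y i : gd (rad^~ i) y (fun k => (k == i)%:R).
Proof.
apply: gd_ext (gdB (gd_coord y i) (gd_cst (x1 0 i) y)) _ => k /=.
by rewrite subr0.
Qed.

Lemma gd_rr y : gd rr y (fun k => 2 * rad y k).
Proof.
apply: gd_ext (gd_sum (fun i => gdM (gd_rad y i) (gd_rad y i))) _ => k /=.
rewrite (bigD1 k)//= eqxx mulr1 big1 ?addr0 ?mulr_natl//.
by move=> i /negbTE ik; rewrite eq_sym ik mulr0 addr0.
Qed.

Lemma rr_continuous y : {for y, continuous rr}.
Proof.
apply: (@cvg_sumr _ _ (nbhs y)) => i.
have c : {for y, continuous (rad^~ i)}.
  by apply: continuousB; [exact: coord_continuous_at|exact: cst_continuous].
exact: cvgM.
Qed.

(** Second derivatives of [u] enter only through the combination in [pdeE] and are replaced by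
    [- f (u y)]. Together with the contribution of the drift, whose coefficient is [p f], this
    leaves [(p - 1) f]. *)
Lemma subsolution_radial (mu : R) (t0 t1 s0 s1 : R -> R) (t2 s2 : R) y :
  Omega y -> 0 < gu y ->
  (forall s : R, is_derive s 1 t0 (t1 s)) -> is_derive (u y) 1 t1 t2 ->
  (\forall s \near rr y, is_derive s (1 : R) s0 (s1 s)) -> is_derive (rr y) 1 s1 s2 ->
  (\forall z \near y, Qu z - mu * (t0 (u z) * s0 (rr z)) <=
                      Qu y - mu * (t0 (u y) * s0 (rr y))) ->
  let g := gu y in let rho := ip (rad y) (vu y) in
  let T0 := t0 (u y) in let T1 := t1 (u y) in
  let S0 := s0 (rr y) in let S1 := s1 (rr y) in
  0 <= mu * (phu y * (2 * T0 * S1 * (n%:R + p - 2) +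
       4 * T0 * s2 * (rr y + (p - 2) * (rho ^+ 2 / g)) +
       4 * (p - 1) * S1 * T1 * rho + (p - 1) * S0 * t2 * g) +
     (p - 1) * f (u y) * S0 * T1 + 2 * p * f (u y) * T0 * S1 * (rho / g)).
Proof.
move=> Oy g0 Dt0 Dt1 Ds0 Ds1 mx; lazy zeta.
set g := gu y; set rho := ip _ _; set T0 := t0 _; set T1 := t1 _; set S0 := s0 _.
set S1 := s1 _.
pose P1 z k := mu * (t0 (u z) * (s1 (rr z) * (2 * rad z k)) + s0 (rr z) * (t1 (u z) * vu z k)).
pose P2 k l := mu * ((T0 * (S1 * (2 * (l == k)%:R) + 2 * rad y k * (s2 * (2 * rad y l))) +
   (S1 * (2 * rad y k)) * (T1 * vu y l)) +
   (S0 * (T1 * Hu y k l + vu y k * (t2 * vu y l)) +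
   (T1 * vu y k) * (S1 * (2 * rad y l)))).
have D1 : \forall z \near y, gd (fun z => mu * (t0 (u z) * s0 (rr z))) z (P1 z).
  near=> z; have Oz : Omega z by near: z; exact: open_near.
  have Dz : is_derive (rr z) 1 s0 (s1 (rr z)).
    near: z.
    exact: (rr_continuous Ds0).
  exact: (gdZ mu (gdM (gd_comp (Dt0 (u z)) (gd_u Oz)) (gd_comp Dz (gd_rr z)))).
have Dt0y : gd (fun z => t0 (u z)) y _ := gd_comp (Dt0 (u y)) (gd_u Oy).
have Dt1y : gd (fun z => t1 (u z)) y _ := gd_comp Dt1 (gd_u Oy).
have Ds0y : gd (fun z => s0 (rr z)) y _ := gd_comp (nbhs_singleton Ds0) (gd_rr y).
have Ds1y : gd (fun z => s1 (rr z)) y _ := gd_comp Ds1 (gd_rr y).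
have D2 i : gd (P1^~ i) y (P2 i).
  apply: (gdZ mu (gdD
    (gdM Dt0y (gdM Ds1y (gdZ 2 (gd_rad y i))))
    (gdM Ds0y (gdM Dt1y (gd_v i Oy))))).
have := p_function_subsolution Oy g0 D1 D2 mx.
set S := tr (Hu y); set a := qf (Hu y) (vu y).
have trI : tr (fun k l : 'I_n => (l == k)%:R) = n%:R :> R.
  rewrite /tr (eq_bigr (fun=> 1)) => [|i _]; last by rewrite eqxx.
  by rewrite sumr_const card_ord.
have qfI : qf (fun k l : 'I_n => (l == k)%:R) (vu y) = g.
  rewrite /qf /g /gu /ip; apply: eq_bigr => i _.
  rewrite (bigD1 i)//= eqxx mul1r big1 ?addr0// => j /negbTE ->.
  by rewrite !mul0r.
(* [P2] regrouped into multiples of the identity, of outer products and of [Hu y], so that trace and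
   quadratic form follow by linearity. *)
pose M k l := mu * (2 * T0 * S1) * (l == k)%:R + mu * (4 * T0 * s2) * (rad y k * rad y l)
  + mu * (2 * S1 * T1) * (rad y k * vu y l) + mu * (S0 * T1) * Hu y k l
  + mu * (S0 * t2) * (vu y k * vu y l) + mu * (2 * T1 * S1) * (vu y k * rad y l).
have P2M k l : P2 k l = M k l by rewrite /P2 /M; ring.
have trP : tr P2 = mu * (2 * T0 * S1 * n%:R + 4 * T0 * s2 * rr y + 4 * S1 * T1 * rho +
    S0 * T1 * S + S0 * t2 * g).
  rewrite (tr_ext P2M) /M !trD !trZ trI !tr_outer -/(rr y) -/rho -/S (ipC (vu y)) -/rho.
  rewrite -/(gu y) -/g; ring.
have qfP : qf P2 (vu y) = mu * (2 * T0 * S1 * g + 4 * T0 * s2 * rho ^+ 2 +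
    4 * S1 * T1 * rho * g + S0 * T1 * a + S0 * t2 * g ^+ 2).
  rewrite (qf_ext _ P2M) /M !qfD !qfZ qfI !qf_outer -/rho -/a -/(gu y) -/g; ring.
have ipP : ip (vu y) (P1 y) = mu * (2 * T0 * S1 * rho + S0 * T1 * g).
  rewrite /P1 ipZr ipDr !ipZr (ipC (vu y)) -/rho -/(gu y) -/g -/T0 -/T1 -/S0 -/S1; ring.
rewrite {}trP {}qfP {}ipP.
have E0 := pdeE Oy g0; rewrite powg1// -/S -/a -/g in E0.
congr (_ <= _).
have fE : f (u y) = - (phu y * S + (p - 2) * (phu y / g * a)) by rewrite -[LHS](subr0) -E0; ring.
have : g != 0 by rewrite gt_eqF.
move: fE; rewrite -/g.
move: (phu y) (f (u y)) (rr y) (g) (rho) (T0) (T1) (S0) (S1) (S) (a).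
by move=> ph fu r g' rh a0 a1 b0 b1 S' a' -> gn0; field.
Unshelve. all: by end_near. Qed.

End Radial.

(** * The Bernstein estimate at a maximum point and the upper bound for [Q] *)

(** Here [X = |grad u|], [s] is the cut-off, [w = 1 / (Rr^2 s)], [z = 1 / (Rr s)], and [T0], [T1]
    are the values of the concave function of [u] and of its derivative; its second derivative is
    [- K T1]. Every cut-off error carries a factor [w], with [w <= z^2] and [w |rho| <= z X]. In
    [K = f0 / m0 + 1] the first summand absorbs the term in [f], and the [1] leaves the term on the
    left of the conclusion. *)
Lemma max_point_bound (N ph X w z s Rr rho B T0 T1 K fu f0 m0 Tm T1m t1 : R) :
  0 <= N + p - 2 -> 0 < ph -> 0 < X -> 0 < w -> 0 < s <= 1 -> 0 < Rr -> z = Rr * w ->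
  w = z ^+ 2 * s -> `|rho| <= Rr * X -> B <= p * Rr ^+ 2 ->
  0 <= T0 <= Tm -> t1 <= T1 -> 0 < t1 -> T1 <= T1m -> K = f0 / m0 + 1 -> `|fu| <= f0 ->
  0 < m0 -> m0 <= ph * X ^+ 2 ->
  0 <= ph * (2 * T0 * (p * w) * (N + p - 2) + 4 * T0 * (p * (p + 1) * w ^+ 2) * B +
         4 * (p - 1) * (p * w) * T1 * rho + (p - 1) * (- K * T1) * X ^+ 2) +
       (p - 1) * fu * T1 + 2 * p * fu * T0 * (p * w) * (rho / X ^+ 2) ->
  (p - 1) * t1 * X ^+ 2 <= (2 * Tm * p * (N + p - 2) + 4 * Tm * p ^+ 2 * (p + 1)) * z ^+ 2 +
     (4 * (p - 1) * p * T1m + 2 * p ^+ 2 * f0 * Tm / m0) * (z * X).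
Proof.
move=> N0 ph0 X0 w0 /andP[s0 s1] R0 zE wE rhoX BR /andP[T00 T0m] T1t t10 T1M KE fuf m00 mph H.
have p0 : 0 < p by rewrite (lt_trans ltr01).
have p10 : 0 < p - 1 by rewrite subr_gt0.
have z0 : 0 < z by rewrite zE mulr_gt0.
have T10 : 0 < T1 by rewrite (lt_le_trans t10).
have f00 : 0 <= f0 by rewrite (le_trans _ fuf).
have zX0 : 0 < z * X by rewrite mulr_gt0.
have wz : w <= z ^+ 2 by rewrite wE ler_piMr// ?exprn_ge0// ltW.
have wr : w * `|rho| <= z * X.
  by rewrite zE [Rr * w]mulrC -mulrA ler_pM2l.
have A1 : 2 * T0 * (p * w) * (N + p - 2) <= 2 * Tm * p * (N + p - 2) * z ^+ 2.
  have -> : 2 * T0 * (p * w) * (N + p - 2) = (2 * p * (N + p - 2)) * (T0 * w) by ring.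
  have -> : 2 * Tm * p * (N + p - 2) * z ^+ 2 = (2 * p * (N + p - 2)) * (Tm * z ^+ 2) by ring.
  apply: ler_wpM2l; first by rewrite mulr_ge0// mulr_ge0// ltW.
  by apply: ler_pM => //; exact: ltW.
have A2 : 4 * T0 * (p * (p + 1) * w ^+ 2) * B <= 4 * Tm * p ^+ 2 * (p + 1) * z ^+ 2.
  apply: (@le_trans _ _ (4 * T0 * (p * (p + 1) * w ^+ 2) * (p * Rr ^+ 2))).
    apply: ler_wpM2l => //; rewrite mulr_ge0//; first by rewrite mulr_ge0.
    by rewrite mulr_ge0 ?exprn_ge0 ?ltW// mulr_gt0// ltr_wpDl// ltW.
  have -> : 4 * T0 * (p * (p + 1) * w ^+ 2) * (p * Rr ^+ 2) =
    (4 * p ^+ 2 * (p + 1) * z ^+ 2) * T0 by rewrite zE; ring.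
  have -> : 4 * Tm * p ^+ 2 * (p + 1) * z ^+ 2 = (4 * p ^+ 2 * (p + 1) * z ^+ 2) * Tm by ring.
  apply: ler_wpM2l => //; rewrite mulr_ge0 ?exprn_ge0 ?ltW// mulr_gt0// ?mulr_gt0 ?exprn_gt0//.
  by rewrite ltr_wpDl// ltW.
have A3 : 4 * (p - 1) * (p * w) * T1 * rho <= 4 * (p - 1) * p * T1m * (z * X).
  have -> : 4 * (p - 1) * (p * w) * T1 * rho = (4 * (p - 1) * p) * (T1 * (w * rho)) by ring.
  rewrite -[_ * T1m * _]mulrA; apply: ler_wpM2l.
    by rewrite mulr_ge0 ?ltW// mulr_gt0.
  apply: (@le_trans _ _ (T1 * (z * X))).
    by rewrite ler_pM2l//; apply: le_trans wr; rewrite ler_pM2l// ler_norm.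
  by rewrite ler_pM2r.
(* The lower bound [m0] on [ph * X^2 = |grad u|^p] supplies the factor [ph] to the two terms that
   lack it. *)
have one : 1 <= ph * X ^+ 2 / m0 by rewrite ler_pdivlMr// mul1r.
have A4 : (p - 1) * fu * T1 <= ph * ((p - 1) * (f0 / m0) * T1 * X ^+ 2).
  apply: (@le_trans _ _ ((p - 1) * f0 * T1)).
    by rewrite ler_pM2r// ler_pM2l// (le_trans (ler_norm _)).
  have -> : ph * ((p - 1) * (f0 / m0) * T1 * X ^+ 2) =
     ((p - 1) * f0 * T1) * (ph * X ^+ 2 / m0) by field; rewrite gt_eqF.
  by apply: ler_peMr => //; rewrite !mulr_ge0// ltW.
have A5 : 2 * p * fu * T0 * (p * w) * (rho / X ^+ 2) <=
    ph * (2 * p ^+ 2 * f0 * Tm / m0 * (z * X)).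
  have X2 : 0 < X ^+ 2 by rewrite exprn_gt0.
  apply: (@le_trans _ _ (2 * p ^+ 2 * (f0 * Tm * (z * X)) / X ^+ 2)).
    have -> : 2 * p * fu * T0 * (p * w) * (rho / X ^+ 2) =
       2 * p ^+ 2 * (fu * T0 * (w * rho)) / X ^+ 2 by ring.
    rewrite ler_pM2r ?invr_gt0// ler_pM2l; last by rewrite mulr_gt0// exprn_gt0.
    rewrite (le_trans (ler_norm _))// !normrM (ger0_norm T00) (gtr0_norm w0).
    apply: ler_pM => //; first by rewrite mulr_ge0.
      by rewrite mulr_ge0// ltW.
    exact: ler_pM.
  have -> : ph * (2 * p ^+ 2 * f0 * Tm / m0 * (z * X)) =
    (2 * p ^+ 2 * (f0 * Tm * (z * X)) / X ^+ 2) * (ph * X ^+ 2 / m0).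
    by field; rewrite !gt_eqF.
  have Tm0 : 0 <= Tm by rewrite (le_trans T00).
  apply: ler_peMr => //; rewrite divr_ge0//; last exact: ltW.
  by rewrite !mulr_ge0// ltW.
have H2 : 0 <= ph * ((2 * Tm * p * (N + p - 2) * z ^+ 2 + 4 * Tm * p ^+ 2 * (p + 1) * z ^+ 2 +
    4 * (p - 1) * p * T1m * (z * X) + (p - 1) * (- K * T1) * X ^+ 2) +
    (p - 1) * (f0 / m0) * T1 * X ^+ 2 + 2 * p ^+ 2 * f0 * Tm / m0 * (z * X)).
  have key (a1 a2 a3 a4 b1 b2 c1 c2 c3 d1 d2 : R) : a1 <= c1 -> a2 <= c2 -> a3 <= c3 ->
      b1 <= ph * d1 -> b2 <= ph * d2 -> 0 <= ph * (a1 + a2 + a3 + a4) + b1 + b2 ->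
      0 <= ph * (c1 + c2 + c3 + a4 + d1 + d2).
    rewrite -(ler_pM2l ph0) -(ler_pM2l ph0 a2) -(ler_pM2l ph0 a3) !mulrDr => *.
    by lra.
  exact: key A1 A2 A3 A4 A5 H.
rewrite pmulr_rge0// KE in H2.
have H3 : (p - 1) * t1 * X ^+ 2 <= (p - 1) * T1 * X ^+ 2.
  by rewrite ler_pM2r ?exprn_gt0// ler_pM2l.
apply: (le_trans H3); rewrite -subr_ge0; move: H2; congr (_ <= _).
by ring.
Qed.

Lemma quadratic_bound (k c1 c2 y : R) : 0 < k -> 0 <= c1 -> 0 <= c2 -> 0 <= y ->
  k * y ^+ 2 <= c1 + c2 * y -> y <= (c1 + c2) / k + 1.
Proof.
move=> k0 c10 c20 y0 H; have [y1|y1] := leP y 1.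
  by rewrite (le_trans y1)// lerDr divr_ge0 ?addr_ge0// ltW.
rewrite (@le_trans _ _ ((c1 + c2) / k))// ?lerDl// ler_pdivlMr//.
have y00 : 0 < y by rewrite (lt_trans _ y1).
rewrite -(ler_pM2r y00) -mulrA mulrC -mulrA -expr2 (le_trans H)// mulrDl lerD2r.
by rewrite ler_peMr// ltW.
Qed.

Lemma rr_ge0 x1 y : 0 <= rr x1 y. Proof. exact: ip_ge0. Qed.

Lemma rr_norm x1 y (r : R) : 0 <= r -> rr x1 y <= r ^+ 2 -> `|x1 - y| <= r.
Proof.
move=> r0 H; rewrite [leLHS]mx_normrE; apply: bigmax_le => // -[i j] _ /=.
rewrite !mxE distrC -(@ler_pXn2r _ 2)// ?nnegrE// real_normK ?num_real//.
rewrite (ord1 i) (le_trans _ H)// /rr /ip (bigD1 j)//= -expr2 lerDl sumr_ge0// => k _.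
by rewrite -expr2 sqr_ge0.
Qed.

Lemma rr_ball x1 y (r : R) : 0 < r -> rr x1 y < r ^+ 2 -> ball x1 r y.
Proof.
move=> r0 H; rewrite -ball_normE /=.
have h : Num.sqrt (rr x1 y) < r.
  by rewrite -(@ltr_pXn2r _ 2)// ?nnegrE ?sqrtr_ge0// ?ltW// sqr_sqrtr ?rr_ge0.
apply: le_lt_trans h; apply: rr_norm; first exact: sqrtr_ge0.
by rewrite sqr_sqrtr// rr_ge0.
Qed.

Lemma compact_closed_rr x1 (A : set V) (r : R) : closed A ->
  compact (A `&` [set y | rr x1 y <= r]).
Proof.
move=> cA; apply: bounded_closed_compact.
  exists (`|x1| + Num.sqrt `|r|); split => // M hM y [_ /= hy].
  have h : `|x1 - y| <= Num.sqrt `|r|.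
    apply: rr_norm; first exact: sqrtr_ge0.
    by rewrite sqr_sqrtr// (le_trans hy)// ler_norm.
  rewrite (le_trans _ (ltW hM))// -[y](subKr x1) (le_trans (ler_normB _ _))//.
  by rewrite lerD2l.
apply: closedI => //.
have -> : [set y | rr x1 y <= r] = rr x1 @^-1` [set t : R | t <= r] by [].
by apply: closed_comp => [y _|]; [exact: rr_continuous|exact: closed_le].
Qed.

Lemma rr_self x1 : rr x1 x1 = 0.
Proof. by rewrite /rr /ip big1// => i _; rewrite /rad subrr mul0r. Qed.

Lemma closure_boundary x : closure Omega x -> Omega x \/ boundary_of Omega x.
Proof.
by move=> cx; have [Ox|nOx] := pselect (Omega x); [left|right; split].
Qed.

(* If [Qu x1 > c], maximise [s^p Qu / ta(u)] where [s = 1 - |x - x1|^2 / Rr^2] and [ta] is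
   concave with values in [[1, 1 + eps]].  The boundary values exclude a maximum on the boundary
   of [Omega], and at an interior maximum the concavity of [ta] gives
   [s |grad u| <= Y0 / Rr] with [Y0] independent of [Rr], so the maximum is too small when
   [Rr] is large.  No a priori bound on [grad u] is needed. *)
Lemma p_function_bound (M c : R) (Qb : V -> R) :
  (0 < n)%N -> 0 <= c -> (forall s, F s <= 0) -> continuous f ->
  {within closure Omega, continuous u} -> {within closure Omega, continuous Qb} ->
  (forall x, Omega x -> Qb x = Qu x) -> (forall x, boundary_of Omega x -> Qb x <= c) ->
  (forall x, Omega x -> 0 < u x <= M) -> (forall x, boundary_of Omega x -> u x = 0) ->
  forall x, Omega x -> Qu x <= c.
Proof.
move=> n0 c0 F0 cf wu wQb QbO Qbc uO ub x1 Ox1.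
rewrite leNgt; apply/negP => Qc.
have p0 : 0 < p by rewrite (lt_trans ltr01).
have M0 : 0 < M by have /andP[/lt_le_trans] := uO _ Ox1; apply.
have uc x : closure Omega x -> 0 <= u x <= M.
  move=> /closure_boundary[/uO/andP[h1 h2]|/ub ->]; first by rewrite h2 ltW.
  by rewrite lexx ltW.
have [f0 f00 Hf0] : exists2 f0, 0 <= f0 & forall s, 0 <= s <= M -> `|f s| <= f0.
  have cn : {within `[0, M], continuous (fun s => `|f s|)}.
    apply: continuous_subspaceT => s; apply: (@continuous_comp _ _ _ f) (cf s) _.
    exact: norm_continuous.
  have [s _ Hs] := EVT_max (ltW M0) cn.
  by exists `|f s| => // t t0; apply: Hs; rewrite in_itv.
(* Since [ta <= 1 + eps], this choice keeps the quotient at [x1] above [c]. *)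
have [eps eps0 epsc] : exists2 eps, 0 < eps & c * (1 + eps) < Qu x1.
  have c10 : 0 < c + 1 by rewrite ltr_wpDl.
  exists ((Qu x1 - c) / (c + 1)); first by rewrite divr_gt0// subr_gt0.
  rewrite mulrDr mulr1 -ltrBrDl mulrCA gtr_pMr ?subr_gt0//.
  by rewrite ltr_pdivrMr// mul1r ltrDl.
have e10 : 0 < 1 + eps by rewrite addr_gt0.
have [mu0 mu0E] : exists m, m = Qu x1 / (1 + eps) by exists (Qu x1 / (1 + eps)).
have mu0c : c < mu0 by rewrite mu0E ltr_pdivlMr.
have mu00 : 0 < mu0 by rewrite (le_lt_trans c0).
pose K := f0 / mu0 + 1.
have K0 : 0 < K by rewrite ltr_wpDl// divr_ge0// ltW.
(* The solution of [ta'' = - K ta'] with [ta 0 = 1] and limit [1 + eps]: its concavity is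
   proportional to its slope, as [max_point_bound] requires. *)
pose ta (s : R) := (1 + eps) + (- eps) * expR (- K * s).
pose ta1 (s : R) := (eps * K) * expR (- K * s).
have Dta (s : R) : is_derive s 1 ta (ta1 s).
  have := is_deriveD (is_derive_cst (1 + eps) s 1) (is_deriveMl (- eps) (is_derive_expRM (- K) s)).
  by move=> H; apply: is_derive_eq H _; rewrite /ta1 add0r; ring.
have Dta1 (s : R) : is_derive s 1 ta1 (- K * ta1 s).
  apply: is_derive_eq (is_deriveMl (eps * K) (is_derive_expRM (- K) s)) _.
  by rewrite /ta1; ring.
have taB s : 0 <= s -> 1 <= ta s <= 1 + eps.
  move=> s0; have e1 : expR (- K * s) <= 1 by rewrite expR_le1 mulNr oppr_le0 mulr_ge0// ltW.
  have e2 := expR_gt0 (- K * s); rewrite /ta; apply/andP; split; last first.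
    by rewrite gerDl mulNr oppr_le0 mulr_ge0// ltW.
  by rewrite -addrA lerDl mulNr subr_ge0 ler_piMr// ltW.
have [t1 t1E] : exists t, t = eps * K * expR (- K * M) by exists (eps * K * expR (- K * M)).
have t10 : 0 < t1 by have e := expR_gt0 (- K * M); rewrite t1E !mulr_gt0.
have ta1B s : 0 <= s <= M -> t1 <= ta1 s <= eps * K.
  move=> /andP[s0 sM]; have eK : 0 < eps * K by rewrite mulr_gt0.
  rewrite t1E /ta1 ler_pM2l// ler_expR !mulNr lerN2 ler_pM2l// sM /=.
  apply: ler_piMr; first exact: ltW.
  by rewrite expR_le1 oppr_le0 mulr_ge0// ltW.
pose N : R := n%:R.
have N0 : 0 <= N + p - 2.
  have : 1 <= N by rewrite /N ler1n.
  by move: p1; lra.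
pose C1 := 2 * (1 + eps) * p * (N + p - 2) + 4 * (1 + eps) * p ^+ 2 * (p + 1).
pose C2 := 4 * (p - 1) * p * (eps * K) + 2 * p ^+ 2 * f0 * (1 + eps) / mu0.
have p10 : 0 < p - 1 by rewrite subr_gt0.
have p0' := ltW p0; have p10' := ltW p10; have e10' := ltW e10; have K0' := ltW K0.
have eps0' := ltW eps0; have mu00' := ltW mu00.
have pp1 : 0 <= p + 1 by rewrite addr_ge0.
have C10 : 0 <= C1 by rewrite /C1; apply: addr_ge0; rewrite !mulr_ge0.
have C20 : 0 <= C2.
  by rewrite /C2; apply: addr_ge0; [rewrite !mulr_ge0|rewrite divr_ge0// !mulr_ge0].
have [k kE] : exists k, k = (p - 1) * t1 by exists ((p - 1) * t1).
have k0 : 0 < k by rewrite kE mulr_gt0.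
pose Y0 := (C1 + C2) / k + 1.
have Y00 : 0 < Y0.
  by apply: ltr_wpDl => //; apply: divr_ge0; [exact: addr_ge0|exact: ltW].
have m0p : 0 < mu0 `^ p^-1 by rewrite powR_gt0.
(* Large enough that [Rr * mu0^(1/p) > Y0], which is contradicted at the end. *)
pose Rr := Y0 / mu0 `^ p^-1 + 1.
have Rr0 : 0 < Rr by apply: ltr_wpDl => //; apply: divr_ge0; exact: ltW.
pose R2 := Rr ^+ 2; have R20 : 0 < R2 by rewrite exprn_gt0.
pose sf y := 1 + (- R2^-1) * rr x1 y.
have sf1 y : sf y <= 1 by rewrite /sf gerDl mulNr oppr_le0 mulr_ge0 ?rr_ge0// invr_ge0 ltW.
have sf_ge y : (0 <= sf y) = (rr x1 y <= R2).
  by rewrite /sf mulNr subr_ge0 mulrC ler_pdivrMr// mul1r.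
have sfc y : {for y, continuous sf}.
  apply: continuousD; first exact: cst_continuous.
  by apply: continuousM; [exact: cst_continuous|exact: rr_continuous].
pose A := closure Omega `&` [set y | rr x1 y <= R2].
pose Phi y := sf y `^ p * Qb y / ta (u y).
have cA : compact A by apply: compact_closed_rr; exact: closed_closure.
have Ax1 : A x1 by split; [exact: subset_closure|rewrite /= rr_self ltW].
have wPhi : {within A, continuous Phi}.
  apply/subspace_continuousP => y Ay.
  have wiu : u z @[z --> within A (nbhs y)] --> u y.
    have /(@continuous_subspaceW _ _ A) : {within closure Omega, continuous u} by [].
    by move=> /(_ (@subIsetl _ _ _)) /subspace_continuousP; apply.
  have wiQ : Qb z @[z --> within A (nbhs y)] --> Qb y.
    have /(@continuous_subspaceW _ _ A) : {within closure Omega, continuous Qb} by [].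
    by move=> /(_ (@subIsetl _ _ _)) /subspace_continuousP; apply.
  have wis : sf z @[z --> within A (nbhs y)] --> sf y.
    by apply: cvg_within_filter; exact: sfc.
  have tac : {for u y, continuous ta}.
    by apply: differentiable_continuous; apply/derivable1_diffP; have [] := Dta (u y).
  have wit : ta (u z) @[z --> within A (nbhs y)] --> ta (u y) by exact: (cvg_comp _ _ wiu tac).
  apply: cvgM; first apply: cvgM => //.
    apply: cvg_powR => //; first by rewrite sf_ge; case: Ay.
    by rewrite near_withinE; apply: nearW => z [_]; rewrite sf_ge.
  apply: cvgV => //.
  have /taB/andP[ta1y _] : 0 <= u y by case: Ay => /uc/andP[].
  by rewrite gt_eqF// (lt_le_trans ltr01).
have A0 : A !=set0 by exists x1.
have [y] := EVT_max_rV A0 cA wPhi; rewrite inE => Ay mx.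
have {}mx z : A z -> Phi z <= Phi y by move=> Az; apply: mx; rewrite inE.
have [cy /= ry] := Ay.
have [mu muE] : exists m, m = Phi y by exists (Phi y).
have mu0mu : mu0 <= mu.
  rewrite muE; apply: le_trans (mx _ Ax1).
  rewrite /Phi /sf rr_self mulr0 addr0 powR1 mul1r QbO// mu0E.
  have /andP[ux1 _] := uO _ Ox1; have /andP[t1' t2'] := taB _ (ltW ux1).
  have ta0 : 0 < ta (u x1) by rewrite (lt_le_trans ltr01).
  by rewrite ler_pM2l ?lef_pV2 ?posrE// (le_lt_trans c0).
have mu_0 : 0 < mu by rewrite (lt_le_trans mu00).
have /andP[uy0 uyM] := uc _ cy; have /andP[ta1y ta2y] := taB _ uy0.
have tay0 : 0 < ta (u y) by rewrite (lt_le_trans ltr01).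
have s0 : 0 < sf y.
  rewrite lt_neqAle sf_ge ry andbT; apply/negP => /eqP s0.
  by move: mu_0; rewrite muE /Phi -s0 powR0 ?gt_eqF// !mul0r ltxx.
have sp0 : 0 < sf y `^ p by rewrite powR_gt0.
have QbE : sf y `^ p * Qb y = mu * ta (u y) by rewrite muE /Phi divfK// gt_eqF.
have sp1 : sf y `^ p <= 1.
  have <- : 1 `^ p = 1 :> R by rewrite powR1.
  by apply: ge0_ler_powR => //; rewrite nnegrE ltW.
have Qbmu : mu <= Qb y.
  rewrite -(ler_pM2l sp0) QbE (@le_trans _ _ mu)//; first by rewrite ler_piMl// ltW.
  by rewrite ler_peMr// ltW.
have Oy : Omega y.
  case: (closure_boundary cy) => // /Qbc; rewrite leNgt => /negP; case.
  by rewrite (lt_le_trans mu0c)// (le_trans mu0mu).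
have Qy : Qu y = Qb y by rewrite QbO.
have Qg : Qu y <= gu y `^ (p / 2).
  rewrite QuE (@le_trans _ _ ((p - 1) / p * gu y `^ (p / 2)))// ?gerDl ?F0//.
  by rewrite ler_piMl ?powR_ge0// ler_pdivrMr// mul1r gerDl lerN10.
have gp : mu <= gu y `^ (p / 2) by rewrite (le_trans Qbmu)// -Qy.
have g0 : 0 < gu y.
  rewrite lt_neqAle gu_ge0 andbT; apply/negP => /eqP g0.
  by move: gp; rewrite -g0 powR0 ?gt_eqF ?divr_gt0// leNgt mu_0.
(* The maximum of the quotient restated as contact: [mu * ta u * s^(-p)] lies above [Qu] near [y]
   and equals it at [y]. *)
have near_mx : \forall z \near y, Qu z - mu * (ta (u z) * (1 + (- R2^-1) * rr x1 z) `^ (- p)) <=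
    Qu y - mu * (ta (u y) * (1 + (- R2^-1) * rr x1 y) `^ (- p)).
  have -> : Qu y - mu * (ta (u y) * (1 + (- R2^-1) * rr x1 y) `^ (- p)) = 0.
    rewrite -/(sf y) powRN Qy mulrA -QbE; apply/eqP.
    by rewrite subr_eq0 mulrAC mulfV ?mul1r// gt_eqF.
  near=> z; have Oz : Omega z by near: z; exact: open_near.
  have sz : 0 < sf z by near: z; have /cvgr_gt := sfc y; exact.
  have Az : A z by split; [exact: subset_closure|rewrite /= -sf_ge ltW].
  have spz : 0 < sf z `^ p by rewrite powR_gt0.
  have /andP[uz _] := uO _ Oz; have /andP[taz _] := taB _ (ltW uz).
  have taz0 : 0 < ta (u z) by rewrite (lt_le_trans ltr01).
  have := mx _ Az; rewrite -muE /Phi ler_pdivrMr// QbO// => h.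
  by rewrite -/(sf z) powRN mulrA subr_le0 ler_pdivlMr// mulrC.
pose s := sf y.
have powS a : s `^ (a - 1) = s `^ a / s.
  rewrite powRB; last by apply/implyP => _; rewrite gt_eqF.
  by rewrite powRr1// ltW.
pose s1 (t : R) := (p * R2^-1) * (1 + (- R2^-1) * t) `^ (- p - 1).
have Ds0 : \forall t \near rr x1 y, is_derive t (1 : R)
    (fun t => (1 + (- R2^-1) * t) `^ (- p)) (s1 t).
  have ca : {for rr x1 y, continuous (fun t : R => 1 + (- R2^-1) * t)}.
    by apply: differentiable_continuous; apply/derivable1_diffP;
       have [] := is_derive_affine 1 (- R2^-1) (rr x1 y).
  near=> t; have t0 : 0 < 1 + (- R2^-1) * t.
    by near: t; have /cvgr_gt := ca; exact.
  by apply: is_derive_eq (is_derive_powR_affine (- p) t0) _; rewrite /s1; ring.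
have Ds1 := is_deriveMl (p * R2^-1) (is_derive_powR_affine (- p - 1) s0).
have H := subsolution_radial Oy g0 Dta (Dta1 (u y)) Ds0 Ds1 near_mx.
lazy zeta in H.
have [w wE] : exists w, w = (R2 * s)^-1 by exists (R2 * s)^-1.
have w0 : 0 < w by rewrite wE invr_gt0 mulr_gt0.
pose X := Num.sqrt (gu y).
have X0 : 0 < X by rewrite sqrtr_gt0.
have X2 : X ^+ 2 = gu y by rewrite sqr_sqrtr ?gu_ge0.
have S00 : 0 < s `^ (- p) by rewrite powR_gt0.
have sn0 : s != 0 by rewrite gt_eqF.
have R2n0 : R2 != 0 by rewrite gt_eqF.
set rho := ip (rad x1 y) (vu y) in H.
set B := rr x1 y + (p - 2) * (rho ^+ 2 / gu y) in H.
have CS : rho ^+ 2 <= rr x1 y * gu y by exact: ip_CauchySchwarz.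
have hB : B <= p * Rr ^+ 2.
  have h1 : rho ^+ 2 / gu y <= rr x1 y by rewrite ler_pdivrMr.
  have h0 : 0 <= rho ^+ 2 / gu y by rewrite divr_ge0 ?sqr_ge0// ltW.
  rewrite (@le_trans _ _ (p * rr x1 y))//; last by rewrite ler_pM2l.
  rewrite /B; move: h1 h0 (rr_ge0 x1 y) p1.
  by move: (rho ^+ 2 / gu y) (rr x1 y) => a b *; nra.
have hrho : `|rho| <= Rr * X.
  have RX0 : 0 <= Rr * X by apply: mulr_ge0; exact: ltW.
  have h : `|rho| ^+ 2 <= (Rr * X) ^+ 2.
    rewrite real_normK ?num_real// exprMn X2; apply: (le_trans CS).
    by rewrite ler_pM2r.
  by rewrite ler_pXn2r ?nnegrE in h.
have hm0 : mu0 <= phu y * X ^+ 2.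
  rewrite X2 /phu mulrC mulr_powRB1 ?gu_ge0// ?divr_gt0//.
  exact: le_trans mu0mu gp.
have fuf : `|f (u y)| <= f0 by apply: Hf0; rewrite uy0.
have wz : w = (Rr * w) ^+ 2 * s.
  by rewrite exprMn -/R2 wE; field; rewrite sn0 R2n0.
have T0m : 0 <= ta (u y) <= 1 + eps by rewrite ta2y ltW.
have /andP[T1a T1b] : t1 <= ta1 (u y) <= eps * K by apply: ta1B; rewrite uy0.
have sb : 0 < s <= 1 by rewrite s0 sf1.
have H2 := max_point_bound N0 (phu_gt0 g0) X0 w0 sb Rr0 erefl wz hrho hB T0m T1a t10 T1b
   erefl fuf mu00 hm0.
have {H H2} : (p - 1) * t1 * X ^+ 2 <= C1 * (Rr * w) ^+ 2 + C2 * (Rr * w * X).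
  apply: H2; move: H; rewrite /s1 -/(sf y) -/s !powS -/N -/K X2.
  have -> : (R2^-1 = w * s)%R by rewrite wE; field; rewrite sn0 R2n0.
  have gn0 : gu y != 0 by rewrite gt_eqF.
  move: (phu y) (ta (u y)) (ta1 (u y)) (f (u y)) (gu y) gn0 (B) (rho) (s `^ (- p)) S00.
  move=> a b c' d e en0 B' r S0 S00 h.
  rewrite -(pmulr_rge0 _ mu_0) -(pmulr_rge0 _ S00); move: h; congr (_ <= _).
  by field; rewrite ?en0 ?sn0.
rewrite -kE => H.
have z0 : 0 < Rr * w by rewrite mulr_gt0.
(* After division by [(Rr w)^2] the estimate is quadratic in [X / (Rr w) = Rr s X], with
   coefficients independent of [Rr]. *)
have : X / (Rr * w) <= Y0.
  apply: quadratic_bound => //; first by rewrite divr_ge0// ltW.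
  rewrite -(ler_pM2r (exprn_gt0 2 z0)) expr_div_n -mulrA divfK ?gt_eqF ?exprn_gt0//.
  apply: (le_trans H); rewrite le_eqVlt; apply/orP; left; apply/eqP.
  by move: (C1) (C2) (X) (Rr * w) (gt_eqF z0) => c1 c2 x z /negbT zn0; field.
have -> : X / (Rr * w) = Rr * (s * X) by rewrite wE /R2; field; rewrite sn0 gt_eqF.
apply/negP; rewrite -ltNge.
have sX0 : 0 <= s * X by rewrite mulr_ge0 ?ltW.
(* [(s X)^p] dominates [s^p Qu y = mu * ta (u y)], which is at least [mu0]; this uses that the
   cut-off has exponent [p]. *)
have : mu0 `^ p^-1 <= s * X.
  have pn0 : p != 0 by rewrite gt_eqF.
  rewrite -[leRHS](powRr1 sX0) -(mulfV pn0) powRrM.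
  apply: ge0_ler_powR; [by rewrite invr_ge0|by rewrite nnegrE|by rewrite nnegrE powR_ge0|].
  have -> : (s * X) `^ p = s `^ p * gu y `^ (p / 2).
    rewrite powRM; [|exact: ltW|exact: ltW].
    by rewrite /X -powR12_sqrt ?gu_ge0// -powRrM [2^-1 * p]mulrC.
  apply: (le_trans mu0mu); rewrite (@le_trans _ _ (mu * ta (u y)))//.
    by rewrite ler_peMr// ltW.
  by rewrite -QbE -Qy ler_pM2l.
move=> /(ler_wpM2l (ltW Rr0)); apply: lt_le_trans.
by rewrite /Rr mulrDl divfK ?gt_eqF// mul1r ltrDl.
Unshelve. all: by end_near. Qed.

(** * Strong maximum principle and the equality case *)

Lemma Qu_continuous x : Omega x -> {for x, continuous Qu}.
Proof.
move=> Ox; have p0 : 0 < p by rewrite (lt_trans ltr01).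
rewrite QuE; apply: continuousD.
  apply: continuousM; first exact: cst_continuous.
  apply: (@cvg_powR _ _ (nbhs x)); rewrite ?divr_gt0 ?gu_ge0//.
    by apply: nearW => z; exact: gu_ge0.
  exact: gu_continuous.
apply: (@continuous_comp _ _ _ u F); first exact: Ck_continuous cu Ox.
apply: differentiable_continuous; apply/derivable1_diffP.
by have [] := dF (u x).
Qed.

Lemma rr_sym x y : rr x y = rr y x.
Proof. by apply: eq_bigr => i _; rewrite /rad; ring. Qed.

(** The constant [(p - 1) / p] is below both [1] and [p - 1], hence bounds the ellipticity from
    below for every [p > 1]. The value of [al] makes the second-order term beat the first-order term
    and the drift. *)
Lemma barrier_strict (N ph g rho r2 fu al phi0 f1 ga d2 R2 : R) :
  0 <= N + p - 2 -> 0 < phi0 -> phi0 <= ph -> 0 < ga -> ga <= g -> 0 <= f1 -> `|fu| <= f1 ->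
  0 < d2 -> d2 <= r2 -> r2 <= R2 -> rho ^+ 2 <= r2 * g ->
  2 * ((p - 1) / p * d2) * al = (N + p - 2) + p * f1 * (R2 / ga + 1) / phi0 + 1 ->
  0 < ph * (2 * al * (r2 + (p - 2) * (rho ^+ 2 / g)) - (N + p - 2)) - p * fu * (rho / g).
Proof.
move=> N0 phi00 phph ga0 gag f10 fuf d20 d2r rR CS alE.
have p0 : 0 < p by rewrite (lt_trans ltr01).
have g0 : 0 < g by rewrite (lt_le_trans ga0).
have ph0 : 0 < ph by rewrite (lt_le_trans phi00).
have r20 : 0 < r2 by rewrite (lt_le_trans d20).
pose y := rho ^+ 2 / g.
have y0 : 0 <= y by rewrite divr_ge0 ?sqr_ge0// ltW.
have yr : y <= r2 by rewrite ler_pdivrMr.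
have la0 : 0 < (p - 1) / p by rewrite divr_gt0// subr_gt0.
have R20 : 0 < R2 by rewrite (lt_le_trans r20).
have Q0 : 0 <= p * f1 * (R2 / ga + 1) / phi0.
  apply: divr_ge0; last exact: ltW.
  apply: mulr_ge0; first by apply: mulr_ge0 => //; exact: ltW.
  by apply: addr_ge0 => //; apply: divr_ge0; exact: ltW.
have al0 : 0 < al.
  have h : 0 < 2 * ((p - 1) / p * d2) by apply: mulr_gt0 => //; apply: mulr_gt0.
  by rewrite -(pmulr_rgt0 _ h) alE; apply: ltr_wpDl => //; apply: addr_ge0.
have B1 : (p - 1) / p * d2 <= r2 + (p - 2) * y.
  apply: (@le_trans _ _ ((p - 1) / p * r2)); first by rewrite ler_pM2l.
  have la1 : (p - 1) / p <= 1 by rewrite ler_pdivrMr// mul1r gerDl lerN10.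
  have la2 : (p - 1) / p <= p - 1.
    rewrite ler_pdivrMr//; have := p1; nra.
  move: la1 la2 y0 yr r20; move: ((p - 1) / p) (y) => l z *.
  have h1 : l * (r2 - z) <= r2 - z by rewrite ler_piMl// subr_ge0.
  have h2 : l * z <= (p - 1) * z by apply: ler_wpM2r.
  by lra.
have B2 : 2 * ((p - 1) / p * d2) * al <= 2 * al * (r2 + (p - 2) * y).
  by rewrite mulrAC ler_pM2l// mulr_gt0.
have rg : `|rho / g| <= R2 / ga + 1.
  rewrite normrM normfV (gtr0_norm g0) ler_pdivrMr// mulrDl mul1r.
  apply: (@le_trans _ _ (R2 + g)).
    have : `|rho| ^+ 2 <= R2 * g.
      rewrite real_normK ?num_real//; apply: le_trans CS _.
      by rewrite ler_pM2r.
    have := normr_ge0 rho; move: (`|rho|) => a a0 h; nra.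
  by rewrite lerD2r mulrAC ler_pdivlMr// ler_pM2l.
have B3 : p * fu * (rho / g) <= ph * (p * f1 * (R2 / ga + 1) / phi0).
  apply: (@le_trans _ _ (p * f1 * (R2 / ga + 1))).
    rewrite -!mulrA ler_pM2l// (le_trans (ler_norm _))// normrM.
    by apply: ler_pM.
  rewrite mulrCA; apply: ler_peMr; last by rewrite ler_pdivlMr// mul1r.
  apply: mulr_ge0; first by apply: mulr_ge0 => //; exact: ltW.
  by apply: addr_ge0 => //; apply: divr_ge0; exact: ltW.
rewrite subr_gt0; apply: (le_lt_trans B3); rewrite ltr_pM2l// -/y.
by apply: (lt_le_trans _ (lerB B2 (lexx _))); rewrite alE; lra.
Qed.

(* Compare [Qu] with [exp (- al |x - z0|^2)] on an annulus centred at a point [z0] close to [x0]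
   where [Qu < c]: the barrier would force [Qu x0 < c]. *)
Lemma p_function_strong_max x0 (c : R) : (0 < n)%N -> continuous f ->
  Omega x0 -> 0 < gu x0 -> (forall x, Omega x -> Qu x <= c) -> Qu x0 = c ->
  \forall z \near x0, Qu z = c.
Proof.
move=> n0 cf Ox0 g0 Qc Qx0.
have N0 : 0 <= n%:R + p - 2.
  have : 1 <= n%:R :> R by rewrite ler1n.
  by move: p1; lra.
have p0 : 0 < p by rewrite (lt_trans ltr01).
have ph0 := phu_gt0 g0.
pose ga := gu x0 / 2; pose phi0 := phu x0 / 2; pose f1 := `|f (u x0)| + 1.
have ga0 : 0 < ga by rewrite divr_gt0.
have phi00 : 0 < phi0 by rewrite divr_gt0.
have f10 : 0 <= f1 by rewrite addr_ge0.
have good : \forall z \near x0, [/\ Omega z, ga <= gu z, phi0 <= phu z & `|f (u z)| <= f1].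
  have h1 : \forall z \near x0, ga < gu z.
    by have /cvgr_gt := gu_continuous Ox0; apply; rewrite /ga ltr_pdivrMr// ltr_pMr// ltr1n.
  have cph : {for x0, continuous phu}.
    apply: (@continuous_comp _ _ _ gu (fun t => t `^ (p / 2 - 1))); first exact: gu_continuous.
    apply: differentiable_continuous; apply/derivable1_diffP.
    by have [] := is_derive1_powR (p / 2 - 1) g0.
  have h2 : \forall z \near x0, phi0 < phu z.
    by have /cvgr_gt := cph; apply; rewrite /phi0 ltr_pdivrMr// ltr_pMr// ltr1n.
  have cfu : {for x0, continuous (fun z => `|f (u z)|)}.
    apply: (@continuous_comp _ _ _ (f \o u) (fun t => `|t|)); last exact: norm_continuous.
    by apply: continuous_comp; [exact: Ck_continuous cu Ox0|exact: cf].
  have h3 : \forall z \near x0, `|f (u z)| < f1.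
    by have /cvgr_lt := cfu; apply; rewrite ltrDl.
  near=> z; split; first by near: z; exact: open_near.
  - by apply: ltW; near: z.
  - by apply: ltW; near: z.
  - by apply: ltW; near: z.
have [r r0 Hr] := near_ex_ball good.
have r4 : 0 < r / 4 by rewrite divr_gt0.
(* With [z0] within [r / 4] of [x0], the Euclidean ball of radius [r / 2] about [z0] contains [x0]
   and stays in [ball x0 r], where the coefficients are controlled. *)
suff key z0 : rr x0 z0 < (r / 4) ^+ 2 -> Qu z0 = c.
  have := @rr_continuous x0 x0 => /cvgr_lt /(_ ((r / 4) ^+ 2)).
  rewrite rr_self exprn_gt0// => /(_ isT) H.
  by near=> z; apply: key; near: z.
move=> rz.
have bz : ball x0 (r / 4) z0 by exact: rr_ball.
have r4r : r / 4 <= r by move: r0; lra.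
have bz' : ball x0 r z0 := le_ball r4r bz.
have Oz : Omega z0 by have [] := Hr z0 bz'.
apply/eqP; rewrite eq_le Qc//= leNgt; apply/negP => Qz.
(* Half the gap at [z0]: on the inner ball [Qu < c - eta], so adding a barrier of size at most [eta]
   keeps the sum below [c]. *)
pose eta := (c - Qu z0) / 2.
have eta0 : 0 < eta by rewrite divr_gt0// subr_gt0.
have cQ : \forall z \near z0, Qu z < c - eta.
  by have /cvgr_lt := Qu_continuous Oz; apply; rewrite /eta; lra.
have [d d0 Hd] := near_ex_ball cQ.
pose R2 := (r / 2) ^+ 2.
have R20 : 0 < R2 by rewrite exprn_gt0// divr_gt0.
pose d2 := (d / 2) ^+ 2.
have d20 : 0 < d2 by rewrite exprn_gt0// divr_gt0.
have Hd2 z : rr z0 z <= d2 -> Qu z < c - eta.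
  move=> h; apply: Hd; apply: rr_ball => //; apply: (le_lt_trans h).
  by rewrite /d2 ltr_pXn2r ?nnegrE ?divr_ge0 ?ltW// ltr_pdivrMr// ltr_pMr// ltr1n.
have HR z : rr z0 z <= R2 -> ball x0 r z.
  move=> h; have h2 : `|z0 - z| <= r / 2 by apply: rr_norm => //; rewrite divr_ge0// ltW.
  move: bz; rewrite -!ball_normE /= => bz.
  have -> : x0 - z = (x0 - z0) + (z0 - z) by rewrite addrA subrK.
  by apply: (le_lt_trans (ler_normD _ _)); move: bz h2 r0; lra.
have la0 : 0 < 2 * ((p - 1) / p * d2).
  by apply: mulr_gt0 => //; apply: mulr_gt0 => //; rewrite divr_gt0// subr_gt0.
have [al alE] : exists al, 2 * ((p - 1) / p * d2) * al =
   (n%:R + p - 2) + p * f1 * (R2 / ga + 1) / phi0 + 1.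
  exists (((n%:R + p - 2) + p * f1 * (R2 / ga + 1) / phi0 + 1) / (2 * ((p - 1) / p * d2))).
  by rewrite mulrC divfK// gt_eqF.
have al0 : 0 < al.
  rewrite -(pmulr_rgt0 _ la0) alE ltr_wpDl// addr_ge0//.
  apply: divr_ge0; last exact: ltW.
  apply: mulr_ge0; first by apply: mulr_ge0 => //; exact: ltW.
  by apply: addr_ge0 => //; apply: divr_ge0; exact: ltW.
pose W y := Qu y + eta * expR (- al * rr z0 y).
pose A := setT `&` [set y | rr z0 y <= R2] `&` [set y | d2 <= rr z0 y].
have cA : compact A.
  apply: compact_closedI; first by apply: compact_closed_rr; exact: closedT.
  have -> : [set y | d2 <= rr z0 y] = rr z0 @^-1` [set t : R | d2 <= t] by [].
  by apply: closed_comp => [y _|]; [exact: rr_continuous|exact: closed_ge].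
have AO y : A y -> Omega y by move=> [[_ /HR/Hr[]]].
have cW y : Omega y -> {for y, continuous W}.
  move=> Oy; apply: continuousD; first exact: Qu_continuous.
  apply: continuousM; first exact: cst_continuous.
  apply: (@continuous_comp _ _ _ (rr z0) (fun t => expR (- al * t))).
    exact: rr_continuous.
  apply: differentiable_continuous; apply/derivable1_diffP.
  by have [] := is_derive_expRM (- al) (rr z0 y).
have rx0 : rr z0 x0 < R2.
  have h : (r / 4) ^+ 2 <= R2 by rewrite /R2; move: r0; nra.
  by rewrite rr_sym (lt_le_trans rz).
have dx0 : d2 < rr z0 x0.
  rewrite ltNge; apply/negP => /Hd2; rewrite Qx0; move: eta0; lra.
have Ax0 : A x0 by split; [split|]; rewrite //= ltW.
have wW : {within A, continuous W}.
  by apply: continuous_in_subspaceT => y; rewrite inE => /AO/cW.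
have A0 : A !=set0 by exists x0.
have [y] := EVT_max_rV A0 cA wW; rewrite inE => Ay mx.
have {}mx z : A z -> W z <= W y by move=> Az; apply: mx; rewrite inE.
have [[_ /= yR] /= yd] := Ay.
have Oy := AO _ Ay.
(* The maximum of [W] is interior: on the outer sphere [W] is at most [c + eta * expR (- al * R2)],
   on the inner one it is below [c], and [W x0] exceeds both. *)
have Wx0 : c + eta * expR (- al * R2) < W x0.
  rewrite /W Qx0 ltrD2l ltr_pM2l// ltr_expR !mulNr ltrN2 ltr_pM2l//.
have Wy := lt_le_trans Wx0 (mx _ Ax0).
have yR' : rr z0 y < R2.
  rewrite lt_neqAle yR andbT; apply/eqP => E.
  by move: Wy; rewrite /W E ltrD2r ltNge Qc.
have yd' : d2 < rr z0 y.
  rewrite lt_neqAle yd andbT; apply/eqP => E.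
  have h1 : Qu y < c - eta by apply: Hd2; rewrite E.
  have h2 : eta * expR (- al * rr z0 y) <= eta.
    apply: ler_piMr; first exact: ltW.
    by rewrite expR_le1 mulNr oppr_le0; apply: mulr_ge0; [exact: ltW|exact: rr_ge0].
  have h3 : 0 < eta * expR (- al * R2) by rewrite mulr_gt0 ?expR_gt0.
  by move: Wy h1 h2 h3; rewrite /W; lra.
have [Oy' gay phy fuy] := Hr _ (HR _ yR).
have gy0 : 0 < gu y by rewrite (lt_le_trans ga0).
have Dt0 (s : R) : is_derive s (1 : R) (fun=> 1 : R) ((fun=> 0) s) by exact: is_derive_cst.
have Dt1 : is_derive (u y) (1 : R) (fun=> 0 : R) 0 by exact: is_derive_cst.
have Ds0 : \forall s \near rr z0 y, is_derive s (1 : R) (fun t => expR (- al * t))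
    ((fun t => - al * expR (- al * t)) s).
  by near=> s; exact: is_derive_expRM.
have Ds1 := is_deriveMl (- al) (is_derive_expRM (- al) (rr z0 y)).
(* The test function is constant in [u] and has [mu = - eta], so that [Qu - psi] is [W]. *)
have nmx : \forall z \near y, Qu z - (- eta) * (1 * expR (- al * rr z0 z)) <=
     Qu y - (- eta) * (1 * expR (- al * rr z0 y)).
  near=> z; rewrite !mul1r ![- eta * _]mulNr !opprK; apply: mx; split; [split=> //|]; rewrite /=.
    by apply: ltW; near: z; have := @rr_continuous z0 y => /cvgr_lt; exact.
  by apply: ltW; near: z; have := @rr_continuous z0 y => /cvgr_gt; exact.
have := subsolution_radial Oy gy0 Dt0 Dt1 Ds0 Ds1 nmx; lazy zeta.
set rho := ip _ _.
have CS : rho ^+ 2 <= rr z0 y * gu y by exact: ip_CauchySchwarz.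
have := barrier_strict N0 phi00 phy ga0 gay f10 fuy d20 yd yR CS alE.
have E0 := expR_gt0 (- al * rr z0 y).
move: E0; move: (expR _) => E E0 S.
apply/negP; rewrite -ltNge.
have : 0 < 2 * al * eta * E * (phu y * (2 * al * (rr z0 y + (p - 2) * (rho ^+ 2 / gu y)) - (n%:R + p - 2)) -
     p * f (u y) * (rho / gu y)).
  by apply: mulr_gt0 => //; apply: mulr_gt0 => //; apply: mulr_gt0 => //; apply: mulr_gt0.
rewrite -oppr_lt0; congr (_ < _).
move: (phu y) (f (u y)) (rho / gu y) (rho ^+ 2 / gu y) (rr z0 y) (gu y) (rho).
by move=> *; ring.
Unshelve. all: by end_near. Qed.

Lemma flat_critical x0 : Omega x0 -> (forall x, Omega x -> Qu x <= 0) ->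
  (exists C : R, \forall s \near u x0, `|F s| <= C * `|s - u x0| `^ p) ->
  \forall z \near x0, u z = u x0.
Proof.
move=> Ox0 Q0 [C0 HC0].
have p0 : 0 < p by rewrite (lt_trans ltr01).
have [C C_ge0 HC] : exists2 C : R, 0 <= C & \forall s \near u x0,
    `|F s| <= C * `|s - u x0| `^ p.
  exists `|C0| => //; near=> s.
  apply: (@le_trans _ _ (C0 * `|s - u x0| `^ p)); first by near: s.
  by rewrite ler_wpM2r ?powR_ge0// ler_norm.
(* Read off from [(p - 1) / p * |grad u|^p <= - F(u) <= C |u - u x0|^p]. *)
pose k := (C * (p / (p - 1))) `^ p^-1.
have k0 : 0 <= k by exact: powR_ge0.
have bnd : \forall z \near x0, Omega z /\ gu z <= k ^+ 2 * (u z - u x0) ^+ 2.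
  have HF : \forall z \near x0, `|F (u z)| <= C * `|u z - u x0| `^ p.
    exact: ((Ck_continuous cu Ox0) _ HC).
  near=> z; have Oz : Omega z by near: z; exact: open_near.
  split => //; have := Q0 z Oz; rewrite QuE => Qz.
  have Fz : `|F (u z)| <= C * `|u z - u x0| `^ p by near: z.
  have h1 : gu z `^ (p / 2) <= C * (p / (p - 1)) * `|u z - u x0| `^ p.
    have p10 : 0 < p - 1 by rewrite subr_gt0.
    have la : 0 < (p - 1) / p by rewrite divr_gt0.
    rewrite -(ler_pM2l la); apply: (@le_trans _ _ `|F (u z)|).
      by rewrite -normrN; apply: le_trans (ler_norm _); move: Qz; lra.
    apply: (le_trans Fz); rewrite le_eqVlt; apply/orP; left; apply/eqP.
    by field; rewrite !gt_eqF.
  have h2 : gu z `^ 2^-1 <= k * `|u z - u x0|.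
    have pn0 : p != 0 by rewrite gt_eqF.
    have -> : gu z `^ 2^-1 = (gu z `^ (p / 2)) `^ p^-1.
      by rewrite -powRrM; congr (_ `^ _); field.
    have -> : k * `|u z - u x0| = (C * (p / (p - 1)) * `|u z - u x0| `^ p) `^ p^-1.
      rewrite powRM ?powR_ge0//; last first.
        by apply: mulr_ge0 => //; apply: divr_ge0; [exact: ltW|rewrite subr_ge0 ltW].
      by rewrite -powRrM mulfV// powRr1.
    apply: ge0_ler_powR => //; rewrite ?invr_ge0 ?nnegrE ?powR_ge0//; first exact: ltW.
    exact: le_trans (powR_ge0 _ _) h1.
  rewrite powR12_sqrt ?gu_ge0// in h2.
  rewrite -(sqr_sqrtr (gu_ge0 z)) -(real_normK (num_real (u z - u x0))) -exprMn.
  by rewrite ler_pXn2r ?nnegrE ?sqrtr_ge0 ?mulr_ge0.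
have [r r0 Hr] := near_ex_ball bnd.
apply/nbhs_ballP; exists r => //= z bz.
pose e := z - x0.
have inb t : 0 <= t <= 1 -> ball x0 r (x0 + t *: e).
  move=> /andP[t0 t1]; move: bz; rewrite -!ball_normE /= opprD addrA subrr add0r normrN normrZ.
  rewrite ger0_norm// -normrN opprB -/e; apply: le_lt_trans.
  by rewrite ler_piMl.
have D (t : R) : 0 <= t <= 1 -> is_derive t (1 : R) (fun t => u (x0 + t *: e) - u x0)
    (ip (vu (x0 + t *: e)) (fun i => e 0 i)).
  move=> t01; have [Ot _] := Hr _ (inb t t01).
  have := is_deriveB (proj1 (is_derive_line u x0 e t _) (gd_u Ot e))
    (is_derive_cst (u x0) t 1).
  by rewrite subr0.
(* On the segment from [x0] to [z], Cauchy-Schwarz turns the gradient bound into the hypothesis of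
   [gronwall_zero] with [L = k |e|]. *)
have := gronwall_zero (L := k * Num.sqrt (ip (fun i => e 0 i) (fun i => e 0 i))) D.
rewrite scale1r scale0r addr0 subrr /e subrKC => H.
apply/eqP; rewrite -subr_eq0; apply/eqP; apply: H => //; last first.
  by apply: mulr_ge0 => //; exact: sqrtr_ge0.
move=> t t01; have [_ gt] := Hr _ (inb t t01).
apply: (le_trans (ip_CauchySchwarz _ _)).
rewrite exprMn sqr_sqrtr ?ip_ge0// mulrAC; apply: ler_wpM2r => //; exact: ip_ge0.
Unshelve. all: by end_near. Qed.

Section Equality.
Variable c : R.
Hypothesis n0 : (0 < n)%N.
Hypothesis cO : connected Omega.
Hypothesis O0 : Omega !=set0.
Hypothesis OT : Omega <> setT.
Hypothesis cf : continuous f.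
Hypothesis c0 : 0 <= c.
Hypothesis F0 : forall s, F s <= 0.
Hypothesis Qc : forall x, Omega x -> Qu x <= c.
Hypothesis wu : {within closure Omega, continuous u}.
Hypothesis u_gt0 : forall x, Omega x -> 0 < u x.
Hypothesis ub : forall x, boundary_of Omega x -> u x = 0.
Hypothesis Fflat : forall u0, F u0 = 0 ->
  exists C : R, \forall s \near u0, `|F s| <= C * `|s - u0| `^ p.
Variable x0 : V.
Hypothesis Ox0 : Omega x0.
Hypothesis Qx0 : Qu x0 = c.

Lemma critical_value x : Omega x -> Qu x = c -> gu x = 0 -> c = 0 /\ F (u x) = 0.
Proof.
have p0 : 0 < p by rewrite (lt_trans ltr01).
move=> Ox; rewrite QuE => + g0; rewrite g0 powR0 ?gt_eqF ?divr_gt0// mulr0 add0r => E.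
have : c = 0 by apply/eqP; rewrite eq_le c0 -E F0.
by move=> c00; rewrite E.
Qed.

Lemma critical_locally_constant x : Omega x -> Qu x = c -> gu x = 0 ->
  \forall z \near x, u z = u x.
Proof.
move=> Ox Qx gx; have [c00 Fx] := critical_value Ox Qx gx.
by apply: flat_critical => // [z Oz|]; [rewrite -c00; exact: Qc|exact: Fflat].
Qed.

Lemma Qu_const x : Omega x -> Qu x = c.
Proof.
move: x; apply: (connected_all oO cO); first by exists x0.
- move=> x Ox Qx; have [g0|g0] := eqVneq (gu x) 0; last first.
    apply: p_function_strong_max => //.
    by rewrite lt_neqAle eq_sym g0 gu_ge0.
  have ux := critical_locally_constant Ox Qx g0.
  (* [u] is constant near each nearby [z] too, so the gradient vanishes at [z] and [Qu z = Qu x]. *)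
  have ux' : \forall z \near x, \forall z' \near z, u z' = u x by exact: near_join ux.
  near=> z.
  have Oz : Omega z by near: z; exact: open_near.
  have uz : \forall z' \near z, u z' = u x by near: z; exact: ux'.
  have vz := gd_unique (gd_near uz (gd_u Oz)) (gd_cst (u x) z).
  have gz : gu z = 0 by rewrite /gu /ip big1// => i _; rewrite vz mul0r.
  by rewrite -Qx !QuE gz g0 (nbhs_singleton uz).
- move=> x Ox /eqP nQ; near=> z; apply/eqP.
  by near: z; have /cvgr_neq := Qu_continuous Ox; exact.
Unshelve. all: by end_near. Qed.

Lemma gu_gt0 x : Omega x -> 0 < gu x.
Proof.
move=> Ox; rewrite lt_neqAle gu_ge0 andbT; apply/eqP => /esym gx.
have [c00 Fx] := critical_value Ox (Qu_const Ox) gx.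
have p0 : 0 < p by rewrite (lt_trans ltr01).
have uE z : Omega z -> u z = u x.
  move: z; apply: (connected_all oO cO); first by exists x.
  (* On the level [u = u x], the equalities [Qu = 0] and [F (u x) = 0] leave no gradient: every
     point of the level is critical, so the level is open. *)
  - move=> z Oz uz; rewrite -uz; apply: critical_locally_constant => //.
      exact: Qu_const.
    have := Qu_const Oz; rewrite c00 QuE uz Fx addr0 => /eqP.
    rewrite mulf_eq0 gt_eqF ?divr_gt0 ?subr_gt0//= powR_eq0 => /andP[/eqP //].
  - move=> z Oz /eqP nu; near=> z'; apply/eqP.
    by near: z'; have /cvgr_neq := Ck_continuous cu Oz; exact.
have [b bb] := boundary_nonempty oO O0 OT.
have [clb nb] := bb.
have : u b = u x.
  apply/eqP; apply: contrapT => /negP nu.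
  move/subspace_continuousP: wu => /(_ _ clb) /cvgr_neq /(_ _ nu).
  rewrite near_withinE => H; have [z [Oz]] := clb _ H.
  by move=> /(_ (subset_closure Oz)) /eqP; apply; exact: uE.
by rewrite (ub bb) => E; have := u_gt0 Ox; rewrite -E ltxx.
Unshelve. all: by end_near. Qed.

(** By [p_function_rigidity] the Hessian is a multiple of [v v^T], so [v] changes only in its own
    direction and the derivative of [v / |v|] vanishes. *)
Lemma direction_const i x : Omega x ->
  vu x i * gu x `^ (- 2^-1) = vu x0 i * gu x0 `^ (- 2^-1).
Proof.
pose N (x : V) := vu x i * gu x `^ (- 2^-1).
have DN y : Omega y -> gd N y (fun=> 0).
  move=> Oy; have g0 := gu_gt0 Oy.
  have Qk : \forall z \near y, Qu z = c.
    by near=> z; apply: Qu_const; near: z; exact: open_near.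
  have rig := p_function_rigidity Oy g0 Qk.
  set a := qf (Hu y) (vu y) in rig.
  apply: gd_ext (gdM (gd_v i Oy) (gd_powg (- 2^-1) Oy g0)) _ => k /=.
  have mvE : mv (Hu y) (vu y) k = a / gu y * vu y k.
    have -> : a / gu y * vu y k = a / gu y ^+ 2 * vu y k * gu y.
      have : gu y != 0 by rewrite gt_eqF.
      by move: (gu y) (a) (vu y k) => g a' v g1; field.
    rewrite /gu /ip mulr_sumr; apply: eq_bigr => j _; rewrite rig.
    by rewrite -/(gu y); ring.
  rewrite mvE rig.
  have -> : gu y `^ (- 2^-1 - 1) = gu y `^ (- 2^-1) / gu y.
    rewrite powRB; last by apply/implyP => _; rewrite gt_eqF.
    by rewrite powRr1// gu_ge0.
  have : gu y != 0 by rewrite gt_eqF.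
  move: (gu y) (gu y `^ _) (a) (vu y k) (vu y i) => g s a' v v' g1.
  by field.
move: x; apply: (connected_all oO cO); first by exists x0.
- move=> y Oy Ny; have [r r0 Hr] := near_ex_ball (open_near oO Oy).
  near=> z; have bz : ball y r z by near: z; exact: nbhsx_ballx.
  suff E : N z = N y by refine (etrans E Ny).
  clear Ny.
  have D t : 0 <= t <= 1 -> is_derive (y + t *: (z - y)) (z - y) N
      ((fun=> 0) (y + t *: (z - y))).
    move=> /andP[t0 t1]; have Ot : Omega (y + t *: (z - y)).
      apply: Hr; move: bz; rewrite -!ball_normE /= opprD addrA subrr add0r normrN normrZ.
      rewrite (ger0_norm t0) (distrC y z) => bz; apply: le_lt_trans bz.
      exact: (ler_piMl (normr_ge0 _) t1).
    apply: is_derive_eq (DN _ Ot (z - y)) _.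
    by rewrite big1// => j _; rewrite mul0r.
  have [t _] := @MVT_dir R V N (fun=> 0) y (z - y) D.
  by rewrite subrKC => /eqP; rewrite subr_eq0 => /eqP.
- move=> y Oy /eqP nN.
  have cN : {for y, continuous N}.
    apply: continuousM; first exact: Ck_continuous (Ck_partial i cu) Oy.
    apply: (@continuous_comp _ _ _ gu (fun t => t `^ (- 2^-1))); first exact: gu_continuous.
    apply: differentiable_continuous; apply/derivable1_diffP.
    by have [] := is_derive1_powR (- 2^-1) (gu_gt0 Oy).
  by near=> z; apply/eqP; near: z; have /cvgr_neq := cN; exact.
Unshelve. all: by end_near. Qed.

Lemma equality_half_space : half_space Omega /\ parallel Omega u.
Proof.
have sq y : Omega y -> gu y `^ (- 2^-1) * gu y `^ (- 2^-1) = (gu y)^-1.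
  move=> Oy; rewrite -powRD; last by apply/implyP => _; rewrite gt_eqF// gu_gt0.
  have -> : - 2^-1 + - 2^-1 = - 1 :> R by field.
  by rewrite powR_inv1// gu_ge0.
(* The constant unit direction: [grad u = |grad u| a] in all of [Omega], with [|grad u|] in the role
   of [s]. *)
pose a : V := \row_i (vu x0 i * gu x0 `^ (- 2^-1)).
apply: (@half_space_parallel R n Omega u a (fun y => gu y `^ 2^-1)) => //.
- rewrite /dotv (eq_bigr (fun i => vu x0 i * vu x0 i * (gu x0)^-1)); last first.
    by move=> i _; rewrite !mxE -sq//; ring.
  by rewrite -mulr_suml mulfV// gt_eqF// gu_gt0.
- by move=> x Ox; rewrite powR_gt0// gu_gt0.
- move=> x e Ox; apply: is_derive_eq (gd_u Ox e) _.
  rewrite /dotv mulr_sumr; apply: eq_bigr => i _; rewrite mxE -(direction_const i Ox).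
  rewrite mulrA mulrCA; congr (_ * _).
  rewrite powRN mulfV ?mulr1// gt_eqF// powR_gt0// gu_gt0//.
Qed.

End Equality.

End PFunction.

(** * Boundary values and conclusion for a proper [C1] domain *)

Theorem theorem1p3 (R : realType) (n : nat) (p kappa : R)
  (Omega : set 'rV[R]_n) (f F : R -> R) (u : 'rV[R]_n -> R) :
  (2 <= n)%N -> 1 < p -> 0 <= kappa ->
  C1_domain Omega -> Omega <> setT ->
  (* f in C^1(R) *)
  (forall s : R, derivable f s 1) -> continuous f -> continuous (derive1 f) ->
  (* u bounded, u in C^3(Omega), u and grad u continuous up to the boundary *)
  (exists M : R, forall x, Omega x -> `|u x| <= M) ->
  Ck 3 Omega u ->
  {within closure Omega, continuous u} ->
  (exists G : 'rV[R]_n -> 'rV[R]_n, {within closure Omega, continuous G} /\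
     (forall x, Omega x -> G x = grad u x) /\
     (* Neumann condition d_nu u = - kappa on the boundary *)
     (forall x nu, boundary_of Omega x -> exterior_normal Omega x nu ->
        dotv (G x) nu = - kappa)) ->
  (* the equation, positivity, Dirichlet condition *)
  (forall x, Omega x -> plap_eq_at p f u x) ->
  (forall x, Omega x -> 0 < u x) ->
  (forall x, boundary_of Omega x -> u x = 0) ->
  (* F in C^2 is a primitive of f, F <= 0 *)
  (forall s : R, is_derive s (1 : R) F (f s)) ->
  (forall s, F s <= 0) ->
  let Q := fun x => (p - 1) / p * enorm (grad u x) `^ p + F (u x) in
  let c := Num.max 0 (F 0 + (p - 1) / p * kappa `^ p) in
  (forall x, Omega x -> Q x <= c) /\
  ((exists x0, Omega x0 /\ Q x0 = c) ->
   (2 < p -> forall u0, F u0 = 0 ->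
      exists C : R, \forall s \near u0, `|F s| <= C * `|s - u0| `^ p) ->
   (exists c', forall x, Omega x -> Q x = c') /\ half_space Omega /\ parallel Omega u).
Proof.
move=> n2 p1 k0 [oO [cO [ne0 C1b]]] OT df cf _ [M uM] cu wu [G [wG [GO Gb]]] pde up ub dF F0.
move=> Q c.
have n0 : (0 < n)%N by rewrite (leq_trans _ n2).
have p0 : 0 < p by rewrite (lt_trans ltr01).
have c0 : 0 <= c by rewrite le_max lexx.
have cF : continuous F.
  move=> s; apply: differentiable_continuous; apply/derivable1_diffP.
  by have [] := dF s.
(* The differential equation and [grad u] are controlled only inside [Omega], so on the boundary [Q]
   is read through the continuous extension [G]. *)
have bound x : Omega x -> Qu p F u x <= c.
  move: x; apply: (p_function_bound p1 oO df dF cu pde (M := M)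
    (Qb := fun x => (p - 1) / p * enorm (G x) `^ p + F (u x))) => //.
  - exact: boundary_P_continuous.
  - by move=> x Ox; rewrite GO.
  - move=> x bx; have [r [rho ld]] := C1b x bx.
    have Gx : enorm (G x) <= kappa.
      apply: (boundary_gradient_norm oO (Ck_S (Ck_S cu)) wu wG GO up ub bx ld k0).
      by apply: (Gb x) => //; exists r, rho.
    rewrite ub// le_max; apply/orP; right; rewrite addrC lerD2l ler_wpM2l//.
      by rewrite divr_ge0 ?subr_ge0 ?ltW.
    by apply: ge0_ler_powR => //; rewrite ?nnegrE ?sqrtr_ge0// ltW.
  - by move=> x Ox; rewrite up//= (le_trans (ler_norm _))// uM.
split; first exact: bound.
move=> [x0 [Ox0 Qx0]] flat.
have Fflat u0 : F u0 = 0 -> exists C : R, \forall s \near u0, `|F s| <= C * `|s - u0| `^ p.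
  move=> Fu0; have [p2|p2] := leP p 2; last exact: flat.
  exact: (@primitive_flat R f F u0 p).
split.
  exists c => x Ox.
  exact: (Qu_const p1 oO df dF cu pde n0 cO cf c0 F0 bound Fflat Ox0 Qx0 Ox).
exact: (equality_half_space p1 oO df dF cu pde n0 cO ne0 OT cf c0 F0 bound wu up ub Fflat Ox0 Qx0).
Qed.
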